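(* Let $p \geq 2$ and let $2 \leq d_1 \leq d_2 \leq \cdots \leq d_p$ be integers such that $$d_p - 1 \;\geq\; \sum_{j=1}^{p-1}(d_j - 1) \;\geq\; 3,$$ and such that all of the following hold: (a) it is not the case that $p = 2$ and $\min(d_1,d_2) = 2$; (b) $f_N(d_1,\ldots,d_p)$ is odd; (c) at least one of $d_1,\ldots,d_p$ is even. Then $f_m(d_1,\ldots,d_p) = f_N(d_1,\ldots,d_p) + 1$.
   Context: A product vector in $\mathbb{C}^{d_1}\otimes\cdots\otimes\mathbb{C}^{d_p}$ is a nonzero vector of the form $v_1\otimes\cdots\otimes v_p$ with $v_j\in\mathbb{C}^{d_j}$. An unextendible product basis (UPB) is a set $S \subseteq \mathbb{C}^{d_1}\otimes\cdots\otimes\mathbb{C}^{d_p}$ of unit product vectors that are pairwise orthogonal and such that no product vector outside $S$ is orthogonal to every element of $S$. $f_m(d_1,\ldots,d_p)$ denotes the minimum cardinality of a UPB in $\mathbb{C}^{d_1}\otimes\cdots\otimes\mathbb{C}^{d_p}$, and $f_N(d_1,\ldots,d_p) := \sum_{j=1}^p (d_j - 1) + 1$. *)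

(* Defs.v *)
From HB Require Import structures.
From mathcomp Require Import all_boot all_order all_algebra.
Set Implicit Arguments. Unset Strict Implicit. Unset Printing Implicit Defensive.
Import Order.TTheory GRing.Theory Num.Theory.
Local Open Scope ring_scope.

(* The scalar field C is a numClosedFieldType (algebraically closed field with
   conjugation x^* and order), playing the role of the complex numbers.
   Local dimensions are d 0, ..., d (p-1) (0-based indexing of d_1..d_p). *)

Definition hinner (C : numClosedFieldType) (n : nat) (u v : 'rV[C]_n) : C :=
  \sum_(i < n) (u 0 i)^* * v 0 i.

(* A product vector v_0 (x) ... (x) v_{p-1} is given by its factors. *)
Definition pvec (C : numClosedFieldType) (p : nat) (d : nat -> nat) :=
  forall j : 'I_p, 'rV[C]_(d j).

Definition pinner (C : numClosedFieldType) (p : nat) (d : nat -> nat)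
  (x y : pvec C p d) : C := \prod_(j < p) hinner (x j) (y j).

Definition pnonzero (C : numClosedFieldType) (p : nat) (d : nat -> nat)
  (x : pvec C p d) : bool := [forall j : 'I_p, x j != 0].

(* S (a finite set of product vectors, listed without repetition; pairwise
   orthogonality of unit vectors forces the listed elements to be distinct, so
   size S is the cardinality) is an unextendible product basis. *)
Definition isUPB (C : numClosedFieldType) (p : nat) (d : nat -> nat)
  (S : seq (pvec C p d)) : Prop :=
  [/\ all (fun x => pnonzero x && (pinner x x == 1)) S,
      pairwise (fun x y => pinner x y == 0) S &
      forall y : pvec C p d, pnonzero y -> has (fun x => pinner x y != 0) S].

Definition fN (p : nat) (d : nat -> nat) : nat := (\sum_(j < p) (d j - 1) + 1)%N.

Definition is_fm (C : numClosedFieldType) (p : nat) (d : nat -> nat) (n : nat) : Prop :=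
  (exists S : seq (pvec C p d), isUPB S /\ size S = n) /\
  (forall S : seq (pvec C p d), isUPB S -> (n <= size S)%N).

(* Main.v *)
Require Import Defs.
From HB Require Import structures.
From mathcomp Require Import all_boot all_order all_algebra.
From mathcomp Require Import cyclic separable cyclotomic zify ring.
From Stdlib Require Import Classical.
Set Implicit Arguments. Unset Strict Implicit. Unset Printing Implicit Defensive.
Import Order.TTheory GRing.Theory Num.Theory.

(** Put [s] for the sum of [d_j - 1] over all parties but the last, [D] for the last
    dimension, and [2n = s + D + 1 = f_N + 1].

    Lower bound: a family of at most [f_N] product vectors is distributed over the parties
    so that party [j] receives at most [d_j - 1] of them; if this cannot be used to extend
    it, the family has exactly [f_N] members and each member is orthogonal to exactly
    [d_j - 1] others at party [j].  For [d_j] even and [f_N] odd this contradicts the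
    handshake lemma.

    Construction: take vertices [left k], [right k] for [k] in Z/n.  The differences
    [k - k'] in [0, s) are cut into intervals of length [d_j - 1], and party [j < p]
    makes [left k] and [right k'] orthogonal when [k - k'] lies in its interval; vectors
    on a moment curve, with generic diagonal weights, realize this in general position.
    The last party must realize all other orthogonalities.  It uses a polynomial [f] with
    [s] coefficients: [left k] and [right k'] are discrete exponentials with inner
    product [sum_j f(w^j) w^{j(k'-k)}].  This lives in dimension [D] when [|f| = 1] at
    [w^0 .. w^s] and [|f| < 1] at the other [n]-th roots of unity, and then a nonzero
    vector is orthogonal to at most [D] vertices as soon as no two exponential sums [x^],
    [y^] with at most [s] terms in total satisfy [x^ = f y^] at [w^0 .. w^s].  Such an [f]
    is found near the constant [1], to first order in the direction of [- g] where [Re g]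
    vanishes at [w^0 .. w^s] and is positive at the other roots, by choosing all but two
    of the values [f(w^j)] generically on the unit circle. *)

(** * Generic choices and exponential sums *)

Section FiniteExceptions.
Variable T : eqType.

Lemma finite_union (I : finType) (bad : I -> T -> Prop) :
  (forall i, exists L : seq T, forall v, bad i v -> v \in L) ->
  exists L : seq T, forall i v, bad i v -> v \in L.
Proof.
move=> h.
suff H (r : seq I) : exists L : seq T, forall i v, i \in r -> bad i v -> v \in L.
  by have [L HL] := H (enum I); exists L => i v; apply: HL; rewrite mem_enum.
elim: r => [|i r [L HL]]; first by exists [::].
have [L' HL'] := h i; exists (L' ++ L) => k v; rewrite in_cons mem_cat.
by case/orP=> [/eqP -> /HL' -> //|kr /(HL _ _ kr) ->]; rewrite orbT.
Qed.

Lemma finite_of_subsingleton (bad : T -> Prop) :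
  (forall v v', bad v -> bad v' -> v = v') -> exists L : seq T, forall v, bad v -> v \in L.
Proof.
move=> h; have [[v hv]|no] := classic (exists v, bad v).
  by exists [:: v] => v' hv'; rewrite inE (h _ _ hv' hv).
by exists [::] => v hv; case: no; exists v.
Qed.

Definition infinite (S : T -> Prop) := forall L : seq T, exists2 v, S v & v \notin L.

(** [Q j] is an invariant of the first [j] values only: it must pass to every [u'] that agrees with
    [u] below [j] and avoids a finite list at [j], so later choices cannot destroy it. *)
Lemma generic_choice (S : nat -> T -> Prop) (Q : nat -> (nat -> T) -> Prop) (u0 : nat -> T) m :
  (forall i, (i < m)%N -> infinite (S i)) ->
  Q 0%N u0 ->
  (forall j u, (j < m)%N -> (forall i, (i < j)%N -> S i (u i)) -> Q j u ->
     exists L : seq T, forall u', (forall i, (i < j)%N -> u' i = u i) ->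
       S j (u' j) -> u' j \notin L -> Q j.+1 u') ->
  exists u, (forall i, (i < m)%N -> S i (u i)) /\ Q m u.
Proof.
move=> inf Q0 QS.
suff: forall j, (j <= m)%N -> exists u, (forall i, (i < j)%N -> S i (u i)) /\ Q j u.
  by apply.
elim=> [|j IH] jm; first by exists u0.
have [u [Su Qu]] := IH (ltnW jm); have [L HL] := QS j u jm Su Qu.
have [v Sv vL] := inf j jm L.
exists (fun i => if i == j then v else u i); split=> [i|].
  by rewrite ltnS leq_eqVlt; case: eqP => [-> //|_ /= ij]; apply: Su.
apply: HL; rewrite ?eqxx // => i ij.
by rewrite (ltn_eqF ij).
Qed.

End FiniteExceptions.

Section ExponentialSums.
Local Open Scope ring_scope.
Variables (C : fieldType) (K : finType) (X : K -> C).
Hypothesis X_inj : injective X.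
Hypothesis X_neq0 : forall k, X k != 0.

Definition expsum (x : K -> C) (i : nat) := \sum_k x k * X k ^+ i.
Definition weight (x : K -> C) := #|[set k | x k != 0]|.

Lemma expsum_lin a b x y i :
  expsum (fun k => a * x k + b * y k) i = a * expsum x i + b * expsum y i.
Proof.
rewrite /expsum !mulr_sumr -big_split /=; apply: eq_bigr => k _.
by rewrite mulrDl !mulrA.
Qed.

Lemma expsum0 x i : (forall k, x k = 0) -> expsum x i = 0.
Proof. by move=> x0; apply: big1 => k _; rewrite x0 mul0r. Qed.

Lemma expsum_poly x i (p : {poly C}) l : (size p <= l)%N ->
  (forall j, (i <= j < i + l)%N -> expsum x j = 0) ->
  \sum_k x k * X k ^+ i * p.[X k] = 0.
Proof.
move=> sp h; rewrite (eq_bigr _ (fun k _ => congr1 _ (horner_coef_wide (X k) sp))).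
under eq_bigr do rewrite mulr_sumr.
rewrite exchange_big big1 //= => j _.
have := h (i + j)%N; rewrite leq_addr ltn_add2l ltn_ord => /(_ isT) h0.
transitivity (p`_j * expsum x (i + j)); last by rewrite h0 mulr0.
rewrite /expsum mulr_sumr; apply: eq_bigr => k _.
by rewrite exprD; ring.
Qed.

(** Tested against the polynomial whose roots are the nodes of the support other than [X k], the sum
    keeps only the term of [k], while [l] consecutive zeros make it vanish. *)
Lemma vandermonde x i l : (weight x <= l)%N ->
  (forall j, (i <= j < i + l)%N -> expsum x j = 0) -> forall k, x k = 0.
Proof.
move=> wx h k; apply/eqP; apply: contraT => xk.
pose A := [set k' | x k' != 0] :\ k.
pose p := \prod_(k' in A) ('X - (X k')%:P).
have sp : (size p <= l)%N.
  rewrite /p -big_enum size_prod_XsubC -cardE; apply: leq_trans wx.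
  by rewrite /weight (cardsD1 k [set _ | _]) inE xk.
have := expsum_poly sp h; rewrite (bigD1 k) //= big1 => [|k' kk']; last first.
  have [->|xk'] := eqVneq (x k') 0; first by rewrite !mul0r.
  rewrite [_.[_]](_ : _ = 0) ?mulr0 //; apply/eqP.
  by rewrite horner_prod prodf_seq_eq0 /=; apply/hasP; exists k';
    rewrite ?mem_index_enum // !inE kk' xk' hornerXsubC subrr eqxx.
move/eqP; rewrite addr0 !mulf_eq0 (negPf xk) expf_eq0 (negPf (X_neq0 k)) andbF /=.
rewrite horner_prod prodf_seq_eq0 => /hasP[k' _] /andP[].
by rewrite !inE hornerXsubC subr_eq0 => /andP[kk' _] /eqP /X_inj e; rewrite e eqxx in kk'.
Qed.


Lemma weight_sub x (A : {set K}) : (forall k, k \notin A -> x k = 0) -> (weight x <= #|A|)%N.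
Proof.
move=> h; apply/subset_leq_card/subsetP => k; rewrite inE.
by apply: contraR => /h ->.
Qed.

Lemma weight0 x : weight x = 0%N -> forall k, x k = 0.
Proof.
move=> /eqP; rewrite cards_eq0 => /eqP h k; apply/eqP; apply: contraT => xk.
have: k \in set0 by rewrite -h inE.
by rewrite inE.
Qed.

(* The rows where [y^] vanishes stand for an infinite value of [u]: this is the leading
   term when the next value of [u] is chosen generically. *)
Definition solves (u : nat -> C) (j l : nat) (x y : K -> C) :=
  (forall i, (i < j)%N -> expsum x i = u i * expsum y i) /\
  (forall i, (j <= i < j + l)%N -> expsum y i = 0).

(** There are [j + l] rows, and only the first [j] of them involve [x]; the two weight bounds are
    the counting conditions under which the kernel can be trivial. *)
Definition independent (u : nat -> C) (j l : nat) := forall x y,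
  (weight x <= j)%N -> (weight x + weight y <= j + l)%N ->
  solves u j l x y -> (forall k, x k = 0) /\ (forall k, y k = 0).

Lemma independent0 u l : independent u 0 l.
Proof.
move=> x y; rewrite leqn0 => /eqP wx; rewrite wx !add0n => wy [_ h].
by split; [apply: weight0 | apply: (@vandermonde _ 0 l)].
Qed.

Lemma solves_lin u j l a b x y x' y' : solves u j l x y -> solves u j l x' y' ->
  solves u j l (fun k => a * x k + b * x' k) (fun k => a * y k + b * y' k).
Proof.
move=> [h1 h2] [h3 h4]; split=> i hi.
  by rewrite !expsum_lin h1 // h3 //; ring.
by rewrite !expsum_lin h2 // h4 // !mulr0 addr0.
Qed.

Lemma weight_lin a b x x' : [set k | x k != 0] = [set k | x' k != 0] ->
  (weight (fun k => (a * x k + b * x' k)%R) <= weight x)%N.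
Proof.
move=> e; apply: weight_sub => k; rewrite inE negbK => /eqP xk.
have: k \notin [set k | x' k != 0] by rewrite -e inE xk eqxx.
by rewrite inE negbK => /eqP ->; rewrite xk !mulr0 addr0.
Qed.

(** For fixed supports and [l], at most one value of [u j] is bad: two bad values give solutions
    that combine to one whose [y^] vanishes at [j] as well, and [independent u j l.+1] kills it. *)
Lemma independentS u j : (forall l, independent u j l) ->
  exists L : seq C, forall u', (forall i, (i < j)%N -> u' i = u i) -> u' j \notin L ->
  forall l, independent u' j.+1 l.
Proof.
move=> ind.
pose bad (t : 'I_#|K|.+1 * ({set K} * {set K})) v := exists x y,
  [/\ [set k | x k != 0] = t.2.1, [set k | y k != 0] = t.2.2,
      (#|t.2.1| <= j)%N, (#|t.2.1| + #|t.2.2| <= j + t.1.+1)%N &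
  [/\ forall i, (i < j)%N -> expsum x i = u i * expsum y i,
      expsum x j = v * expsum y j,
      forall i, (j < i < j + t.1.+1)%N -> expsum y i = 0 & expsum y j != 0]].
have [L HL] : exists L : seq C, forall t v, bad t v -> v \in L.
  apply: finite_union => -[l [A B]]; apply: finite_of_subsingleton => v v'.
  move=> [x [y [/= eA eB wA wAB [h1 h2 h3 h4]]]] [x' [y' [/= eA' eB' _ _ [h1' h2' h3' h4']]]].
  set a := expsum y' j; set b := - expsum y j.
  have [] := ind l.+1 (fun k => a * x k + b * x' k) (fun k => a * y k + b * y' k).
  - by apply: leq_trans (weight_lin _ _ _) _; rewrite ?eA // /weight eA.
  - apply: leq_trans wAB; apply: leq_add; apply: leq_trans (weight_lin _ _ _) _;
      by rewrite ?eA ?eB // /weight ?eA ?eB.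
  - split=> i hi; rewrite !expsum_lin; first by rewrite h1 // h1' //; ring.
    have [->|ij] := eqVneq i j; first by rewrite /a /b; ring.
    have hi' : (j < i < j + l.+1)%N by move: hi ij; lia.
    by rewrite h3 // h3' // !mulr0 addr0.
  move=> zx _; have := expsum_lin a b x x' j.
  rewrite expsum0 // h2 h2' /a /b => e.
  have : (v - v') * (expsum y j * expsum y' j) = 0 by rewrite [RHS]e; ring.
  move/eqP; rewrite !mulf_eq0 (negPf h4) (negPf h4') !orbF subr_eq0.
  by move/eqP.
exists L => u' u'u u'L l x y wx wxy [h1 h2].
(* If [y] has weight at most [l], its zero rows already kill it and [x] is left with [j.+1]
   equations. Otherwise [weight x <= j] and [l < #|K|], which is why [bad] needs only finitely many
   [l]. *)
have [yj|yj] := leqP (weight y) l.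
  have y0 := vandermonde yj h2; split=> //.
  apply: (vandermonde (i := 0) wx) => i /= ij; rewrite h1 ?ij //.
  by rewrite expsum0 // mulr0.
have wx' : (weight x <= j)%N by lia.
have [lK|Kl] := ltnP l #|K|.+1; last first.
  by have := max_card (mem [set k | y k != 0]); rewrite -/(weight y); lia.
have [yj0|yj0] := eqVneq (expsum y j) 0; last first.
  case/negP: u'L; apply: (HL (Ordinal lK, ([set k | x k != 0], [set k | y k != 0]))).
  exists x, y; split=> //=; first by rewrite -/(weight x) -/(weight y); lia.
  split=> // [i ij||i ij]; [by rewrite h1 ?u'u // ltnW|exact: h1|by apply: h2; lia].
apply: (ind l.+1); rewrite ?addnS //; split=> i ij; first by rewrite h1 ?u'u // ltnW.
have [-> //|ne] := eqVneq i j; apply: h2; lia.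
Qed.

Lemma independent_exists (S : nat -> C -> Prop) m :
  (forall i, (i < m)%N -> infinite (S i)) ->
  exists u, (forall i, (i < m)%N -> S i (u i)) /\ forall l, independent u m l.
Proof.
move=> inf.
have [] := @generic_choice _ S (fun j u => forall l, independent u j l) (fun _ => 0) m inf.
- by move=> l; apply: independent0.
- move=> j u _ _ /independentS [L HL]; exists L => u' e _ u'L; exact: HL.
by move=> u h; exists u.
Qed.

End ExponentialSums.

(** * The linkage relation *)

Section Linkage.
Local Open Scope ring_scope.
Variable C : numClosedFieldType.
Implicit Types (a b c d v w : C).

Lemma normCK_eq0 a : (a * a^* == 0) = (a == 0).
Proof. by rewrite mulf_eq0 conjC_eq0 orbb. Qed.

Lemma norm1_conj v : `|v| = 1 -> v * v^* = 1.
Proof. by move=> h; rewrite -normCK h expr1n. Qed.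

Lemma roots_finite (p : {poly C}) : p != 0 -> exists L : seq C, forall v, root p v -> v \in L.
Proof.
move=> p0; have [r Hr] := closed_field_poly_normal p; exists r => v.
by rewrite Hr rootZ ?lead_coef_eq0 // root_prod_XsubC.
Qed.

(* The four-bar relation [l v + r + ly U + lx V = 0] between unit numbers is not
   implied by any Moebius relation between [v] and [U]. *)
Lemma linkage_identities (al be ga de l ly lx r : C) :
  let g2 := l * de in let g1 := l * ga + r * de + ly * be in let g0 := r * ga + ly * al in
  l != 0 -> ly != 0 -> r != 0 ->
  r * r^* != lx * lx^* -> r * r^* != ly * ly^* ->
  de != 0 \/ [/\ be = 0, de = 0 & ga != 0] ->
  be * al^* = de * ga^* ->
  al * al^* + be * be^* = ga * ga^* + de * de^* ->
  g2 * g0^* = 0 -> g1 * g0^* + g2 * g1^* = lx * lx^* * (de * ga^*) ->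
  g0 * g0^* + g1 * g1^* + g2 * g2^* = lx * lx^* * (ga * ga^* + de * de^*) -> False.
Proof.
move=> g2 g1 g0 l0 ly0 r0 rX rY cases E1 E0 F2 F1 F0.
(* The first premise gives [|r| |ga| = |ly| |al|], while [|r|] and [|ly|] differ. *)
have zero_of_modulus : r * ga = - (ly * al) -> ga * ga^* = al * al^* -> ga = 0.
  move=> e1 e2; have := congr1 (fun z => z * z^*) e1.
  rewrite rmorphN !rmorphM /= mulrNN => e3; apply/eqP; apply: contraT => ga0.
  case/negP: rY; apply/eqP/(mulIf (x := ga * ga^*)); first by rewrite normCK_eq0.
  by rewrite mulrACA e3 mulrACA e2.
case: cases => [de0|[be0 de0 ga0]]; last first.
  move: F1 E0; rewrite /g2 /g1 de0 be0 !(mulr0, mul0r, addr0) => /eqP.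
  rewrite mulf_eq0 conjC_eq0 mulf_eq0 (negPf l0) (negPf ga0) /= addr_eq0 => /eqP e1 e2.
  by rewrite (zero_of_modulus e1) ?eqxx // in ga0.
move/eqP: F2; rewrite !mulf_eq0 conjC_eq0 (negPf l0) (negPf de0) /= => /eqP G0.
move: F1 F0; rewrite G0 !(conjC0, mulr0, mul0r, add0r) => F1 F0.
have e1 : r * ga = - (ly * al) by apply/eqP; rewrite -addr_eq0; apply/eqP.
have H1 : l * g1^* = lx * lx^* * ga^*.
  by apply: (mulIf de0); rewrite -[RHS]mulrA [ga^* * _]mulrC -F1 /g2; ring.
have H1' : l^* * g1 = lx * lx^* * ga.
  by have := congr1 (fun z => z^*) H1; rewrite !rmorphM /= !conjCK => ->; ring.
have [ga0|ga0] := eqVneq ga 0.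
  have al0 : al = 0.
    move/eqP: e1; rewrite ga0 mulr0 eq_sym oppr_eq0 mulf_eq0 (negPf ly0) => /eqP //.
  have g10 : g1 = 0.
    by move/eqP: H1'; rewrite ga0 mulr0 mulf_eq0 conjC_eq0 (negPf l0) => /eqP.
  move: E0 g10; rewrite /g1 ga0 al0 !(mulr0, mul0r, add0r) => E0 /eqP.
  rewrite addr_eq0 => /eqP /(congr1 (fun z => z * z^*)).
  rewrite rmorphN !rmorphM /= mulrNN => e3.
  case/negP: rY; apply/eqP/(mulIf (x := de * de^*)); first by rewrite normCK_eq0.
  by rewrite -{2}E0; transitivity (r * de * (r^* * de^*)); [ring|rewrite e3; ring].
have ne : ga * ga^* != al * al^*.
  by apply/eqP => /(zero_of_modulus e1) h; rewrite h eqxx in ga0.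
have al0 : al != 0.
  apply: contraNneq ga0 => al0; move/eqP: e1.
  by rewrite al0 mulr0 oppr0 mulf_eq0 (negPf r0).
(* From here squared moduli are compared. By [E0] and [E1], [|al|^2] and [|be|^2] have the same sum
   and product as [|ga|^2] and [|de|^2], so [|al| = |de|] because [|al| = |ga|] is excluded. *)
set X := lx * lx^* in rX F1 F0 H1 H1'; set Y := ly * ly^* in rY.
set g := ga * ga^* in E0 F0 ne; set d := de * de^* in E0 F0.
have g_neq0 : g != 0 by rewrite normCK_eq0.
have d_neq0 : d != 0 by rewrite normCK_eq0.
set ro := r * r^* in rX rY; set ll := l * l^*.
have ll_neq0 : ll != 0 by rewrite normCK_eq0.
have eal : al * al^* = d.
  have e2 : (be * be^*) * (al * al^*) = d * g.
    have e3 := congr1 (fun z => z * z^*) E1.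
    rewrite !rmorphM /= !conjCK in e3.
    by transitivity (be * al^* * (be^* * al)); [ring|rewrite e3 /d /g; ring].
  have: (al * al^* - g) * (al * al^* - d) = 0.
    have -> : (al * al^* - g) * (al * al^* - d) =
      al * al^* * (al * al^* + be * be^* - g - d) - ((be * be^*) * (al * al^*) - d * g) by ring.
    by rewrite E0 e2; ring.
  by move/eqP; rewrite mulf_eq0 !subr_eq0 [_ == g]eq_sym (negPf ne) /= => /eqP.
have rg : ro * g = Y * d.
  have := congr1 (fun z => z * z^*) e1; rewrite rmorphN !rmorphM /= mulrNN => e3.
  by rewrite -eal; transitivity (r * ga * (r^* * ga^*)); [rewrite /ro /g; ring|rewrite e3 /Y; ring].
have e4 : (X - ll) * (X * g - ll * d) = 0.
  have e5 : ll * (g1 * g1^*) = X ^+ 2 * g.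
    by transitivity ((l^* * g1) * (l * g1^*)); [rewrite /ll; ring|rewrite H1 H1' /g; ring].
  have e6 : ll * (g1 * g1^* + g2 * g2^*) = ll * (X * (g + d)) by rewrite F0.
  have e7 : g2 * g2^* = ll * d by rewrite /g2 rmorphM /= /ll /d; ring.
  move: e6; rewrite mulrDr e5 e7 => e6.
  transitivity (X ^+ 2 * g + ll * (ll * d) - ll * (X * (g + d))); first by ring.
  by rewrite e6 subrr.
have e5 : (X - ll) * ga * d = l^* * r * de * (d - g).
  have e6 : al * al^* * (ly * be) = - (r * de * g).
    transitivity ((ly * al) * (be * al^*)); first by ring.
    rewrite E1 -[ly * al]opprK -e1 /g; ring.
  rewrite eal in e6.
  have : X * ga * d = l^* * g1 * d by rewrite H1'.
  rewrite /g1 => e7.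
  transitivity (X * ga * d - ll * ga * d); first by ring.
  rewrite e7.
  transitivity (l^* * (r * de * d + d * (ly * be))); first by rewrite /ll; ring.
  by rewrite e6; ring.
have dg : d - g != 0.
  apply: contraNneq rY => /eqP; rewrite subr_eq0 => /eqP dg.
  by apply/eqP/(mulIf g_neq0); rewrite rg dg.
(* The first factor is excluded by [e5]. In the second case [X * g = ll * d]; together with [e5] and
   [rg] this gives [ll = Y], and then [rg] becomes [ro = X], against [rX]. *)
move/eqP: e4; rewrite mulf_eq0 !subr_eq0 => /orP[/eqP Xll|/eqP e4].
  move/eqP: e5; rewrite Xll subrr !mul0r eq_sym !mulf_eq0 conjC_eq0.
  by rewrite (negPf l0) (negPf r0) (negPf de0) (negPf dg).
have e6 : (X - ll) ^+ 2 * g * d ^+ 2 = ll * ro * d * (d - g) ^+ 2.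
  have e5c : (X - ll) * ga^* * d = l * r^* * de^* * (d - g).
    move: (congr1 (fun z => z^*) e5); rewrite /X /ll /d /g.
    by rewrite !(rmorphM, rmorphB) /= !conjCK => e6; apply: (etrans _ (etrans e6 _)); ring.
  transitivity ((X - ll) * ga * d * ((X - ll) * ga^* * d)); first by rewrite /g; ring.
  by rewrite e5 e5c /ll /ro /d; ring.
have Xll : X - ll != 0.
  apply: contraNneq dg => /eqP; rewrite subr_eq0 => /eqP h.
  by move: e4; rewrite h => /(mulfI ll_neq0) gd; rewrite gd subrr eqxx.
have e7 : ll * (d - g) = (X - ll) * g by rewrite mulrBr -e4; ring.
have e8 : ll = Y.
  apply: (mulIf (x := (X - ll) ^+ 2 * d ^+ 2 * g * ll)).
    exact: (mulf_neq0 (mulf_neq0 (mulf_neq0 (expf_neq0 2 Xll) (expf_neq0 2 d_neq0)) g_neq0) ll_neq0).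
  transitivity (ll ^+ 2 * ((X - ll) ^+ 2 * g * d ^+ 2)); first by ring.
  rewrite e6.
  transitivity (ro * d * ll * (ll * (d - g)) ^+ 2); first by ring.
  rewrite e7.
  transitivity ((ro * g) * d * ll * (X - ll) ^+ 2 * g); first by ring.
  by rewrite rg; ring.
case/negP: rX; apply/eqP/(mulIf g_neq0).
by rewrite rg -e8 e4.
Qed.

(** Substituting [U = (al + be v) / (ga + de v)] makes [|U| = 1] and [|V| = 1] polynomial equations
    in [v], because conjugation is inversion on the unit circle. These are [p1] and [p2]; if both
    polynomials are zero, their coefficients satisfy the hypotheses of [linkage_identities]. *)
Lemma linkage_finite (al be ga de l ly lx r : C) :
  l != 0 -> ly != 0 -> r != 0 ->
  r * r^* != lx * lx^* -> r * r^* != ly * ly^* ->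
  de != 0 \/ [/\ be = 0, de = 0 & ga != 0] ->
  exists L : seq C, forall v, `|v| = 1 ->
    (exists U V, [/\ `|U| = 1, `|V| = 1, l * v + r + ly * U + lx * V = 0 &
       al + be * v = U * (ga + de * v)]) -> v \in L.
Proof.
move=> l0 ly0 r0 rX rY cases.
set g2 := l * de; set g1 := l * ga + r * de + ly * be; set g0 := r * ga + ly * al.
pose p1 := Poly [:: be^* * al - de^* * ga; al * al^* + be * be^* - (ga * ga^* + de * de^*);
   be * al^* - de * ga^*].
pose p2 := Poly [:: g0 * g2^*; g0 * g1^* + g1 * g2^* - lx * lx^* * (de^* * ga);
   g0 * g0^* + g1 * g1^* + g2 * g2^* - lx * lx^* * (ga * ga^* + de * de^*);
   g1 * g0^* + g2 * g1^* - lx * lx^* * (de * ga^*); g2 * g0^*].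
have [p10|p10] := eqVneq p1 0; last first.
  have [L HL] := roots_finite p10; exists L => v v1 [U [V [U1 V1 _ e]]]; apply: HL.
  have := congr1 (fun z => z * z^*) e.
  rewrite rmorphM /= mulrACA (norm1_conj U1) mul1r !rmorphD !rmorphM /= => e'.
  rewrite /root horner_Poly /= mul0r add0r; have vv := norm1_conj v1.
  apply/eqP; transitivity (v * ((al + be * v) * (al^* + be^* * v^*) -
    (ga + de * v) * (ga^* + de^* * v^*)) + (1 - v * v^*) * (al * be^* + be * be^* * v - ga * de^* - de * de^* * v)).
    by ring.
  by rewrite e' vv !subrr mulr0 mul0r addr0.
have [p20|p20] := eqVneq p2 0; last first.
  have [L HL] := roots_finite p20; exists L => v v1 [U [V [U1 V1 e e2]]]; apply: HL.
  have e3 : g0 + g1 * v + g2 * v ^+ 2 = - (lx * V * (ga + de * v)).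
    apply/eqP; rewrite -addr_eq0; apply/eqP.
    transitivity ((l * v + r) * (ga + de * v) + ly * (al + be * v) + lx * V * (ga + de * v)).
      by rewrite /g0 /g1 /g2; ring.
    rewrite e2; transitivity ((l * v + r + ly * U + lx * V) * (ga + de * v)); first by ring.
    by rewrite e mul0r.
  clearbody g0 g1 g2; have := congr1 (fun z => z * z^*) e3.
  rewrite rmorphN !rmorphM /= mulrNN !rmorphD !rmorphM /= => e'.
  rewrite /root horner_Poly /= mul0r add0r; have vv := norm1_conj v1; have VV := norm1_conj V1.
  have vV : v^* = v^-1 by rewrite -[LHS]mul1r -(divff (_ : v != 0)) 1?mulrAC ?vv ?mul1r // -normr_eq0 v1 oner_eq0.
  have v0 : v != 0 by rewrite -normr_eq0 v1 oner_eq0.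
  apply/eqP; transitivity (v ^+ 2 * ((g0 + g1 * v + g2 * v ^+ 2) * (g0^* + g1^* * v^-1 + g2^* * (v^-1 * v^-1)) -
     lx * lx^* * ((ga + de * v) * (ga^* + de^* * v^-1)))).
    by field.
  rewrite -vV e'; transitivity (v ^+ 2 * (lx * lx^* * (V * V^* - 1) * ((ga + de * v) * (ga^* + de^* * v^*)))).
    by ring.
  by rewrite VV subrr !(mulr0, mul0r).
exfalso; apply: (@linkage_identities al be ga de l ly lx r) => //; rewrite -/g0 -/g1 -/g2.
- by have := congr1 (fun p : {poly C} => p`_2) p10; rewrite coef_Poly coef0 /= => /eqP; rewrite subr_eq0 => /eqP.
- by have := congr1 (fun p : {poly C} => p`_1) p10; rewrite coef_Poly coef0 /= => /eqP; rewrite subr_eq0 => /eqP.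
- by have := congr1 (fun p : {poly C} => p`_4) p20; rewrite coef_Poly coef0 /=.
- by have := congr1 (fun p : {poly C} => p`_3) p20; rewrite coef_Poly coef0 /= => /eqP; rewrite subr_eq0 => /eqP.
- by have := congr1 (fun p : {poly C} => p`_2) p20; rewrite coef_Poly coef0 /= => /eqP; rewrite subr_eq0 => /eqP.
Qed.

End Linkage.

(** * Choosing the last two values on the unit circle *)

Section LastRows.
Local Open Scope ring_scope.
Variables (C : numClosedFieldType) (K : finType) (X : K -> C).
Hypothesis X_inj : injective X.
Hypothesis X_neq0 : forall k, X k != 0.

(** For fixed supports, a solution of the first [m] rows is determined by the values of [y^] at [m]
    and [m.+1], so the solutions form a space of dimension at most two. Elimination turns the two
    remaining rows into a Moebius relation between [v] and [U], to which [linkage_finite]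
    applies. *)
Lemma last_two_rows (u : nat -> C) m (l ly lx r : C) :
  independent X u m 2 -> l != 0 -> ly != 0 -> r != 0 ->
  r * r^* != lx * lx^* -> r * r^* != ly * ly^* ->
  exists L : seq C, forall v, v \notin L -> `|v| = 1 -> forall U V, `|U| = 1 -> `|V| = 1 ->
    l * v + r + ly * U + lx * V = 0 ->
    forall x y, (weight x <= m)%N -> (weight x + weight y <= m.+2)%N ->
    (forall i, (i < m)%N -> expsum X x i = u i * expsum X y i) ->
    expsum X x m = v * expsum X y m -> expsum X x m.+1 = U * expsum X y m.+1 ->
    (forall k, x k = 0) /\ (forall k, y k = 0).
Proof.
move=> ind l0 ly0 r0 rX rY.
pose sol (AB : {set K} * {set K}) v U (x y : K -> C) :=
  [/\ forall k, k \notin AB.1 -> x k = 0, forall k, k \notin AB.2 -> y k = 0,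
      solves X u m 0 x y, expsum X x m = v * expsum X y m &
      expsum X x m.+1 = U * expsum X y m.+1].
pose bad (AB : {set K} * {set K}) v := [/\ (#|AB.1| <= m)%N, (#|AB.1| + #|AB.2| <= m.+2)%N,
  `|v| = 1 & exists U V x y, [/\ `|U| = 1, `|V| = 1, l * v + r + ly * U + lx * V = 0,
      sol AB v U x y & (expsum X y m != 0) || (expsum X y m.+1 != 0)]].
have elim (AB : {set K} * {set K}) (x y : K -> C) : (#|AB.1| <= m)%N -> (#|AB.1| + #|AB.2| <= m.+2)%N ->
    (forall k, k \notin AB.1 -> x k = 0) -> (forall k, k \notin AB.2 -> y k = 0) ->
    solves X u m 0 x y -> expsum X y m = 0 -> expsum X y m.+1 = 0 ->
    expsum X x m = 0 /\ expsum X x m.+1 = 0.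
  move=> cA cAB xA yB [h _] y0 y1; have [] := ind x y.
  - exact: leq_trans (weight_sub xA) cA.
  - rewrite addn2; apply: leq_trans cAB; exact: leq_add (weight_sub xA) (weight_sub yB).
  - split=> // i /andP[mi im]; have [->//|ne] := eqVneq i m.
    by have -> : i = m.+1 by move: mi im ne; lia.
  by move=> x0 _; rewrite !expsum0.
suff [L HL] : exists L : seq C, forall AB v, bad AB v -> v \in L.
  exists L => v vL v1 U V U1 V1 e x y wx wxy h1 h2 h3.
  have [yz|yn] := boolP ((expsum X y m != 0) || (expsum X y m.+1 != 0)).
    case/negP: vL; apply: (HL ([set k | x k != 0], [set k | y k != 0])).
    split=> //; exists U, V, x, y; split=> //; split=> //.
    - by move=> k /=; rewrite inE negbK => /eqP.
    - by move=> k /=; rewrite inE negbK => /eqP.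
    - by split=> // i; lia.
  move: yn; rewrite negb_or !negbK => /andP[/eqP y0 /eqP y1].
  apply: (ind x y); rewrite ?addn2 //; split=> // i /andP[mi im].
  by have [->//|ne] := eqVneq i m; have -> : i = m.+1 by move: mi im ne; lia.
apply: finite_union => AB.
(* Either two bad values have solutions whose pairs of values of [y^] at [m] and [m.+1] are linearly
   independent, and these two solutions span all others, or all such pairs are proportional. *)
have [[v1 [v2 [b1 [b2 H]]]]|H] := classic (exists v1 v2, bad AB v1 /\ bad AB v2 /\
   exists U1 x1 y1 U2 x2 y2, sol AB v1 U1 x1 y1 /\ sol AB v2 U2 x2 y2 /\
     expsum X y1 m * expsum X y2 m.+1 != expsum X y2 m * expsum X y1 m.+1).
  have [U1 [x1 [y1 [U2 [x2 [y2 [s1 [s2 ne]]]]]]]] := H.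
  case: s1 => xA1 yB1 sv1 e1 e1'; case: s2 => xA2 yB2 sv2 e2 e2'.
  set p1 := expsum X y1 m in e1 ne; set q1 := expsum X y1 m.+1 in e1' ne.
  set p2 := expsum X y2 m in e2 ne; set q2 := expsum X y2 m.+1 in e2' ne.
  (* The coefficients come from expanding [D = 0] below, where [D] is the determinant of the linear
     equations [g1] and [g2] in the unknowns [c1] and [c2]. *)
  have [|L HL] := @linkage_finite _ (p1 * q2 * v1 * U2 - p2 * q1 * v2 * U1)
     (- (p1 * q2 * U2 - p2 * q1 * U1)) (p1 * q2 * v1 - p2 * q1 * v2) (- (p1 * q2 - p2 * q1))
     l ly lx r l0 ly0 r0 rX rY.
    by left; rewrite oppr_eq0 subr_eq0.
  exists L => v [cA cAB nv [U [V [x [y [nU nV rel [xA yB sv e e'] yn]]]]]].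
  apply: HL => //; exists U, V; split=> //.
  set p := expsum X y m in e yn; set q := expsum X y m.+1 in e' yn.
  (* Cramer's rule: [dl] times [(p, q)] is [c1] times [(p1, q1)] plus [c2] times [(p2, q2)]. *)
  pose c1 := p * q2 - p2 * q; pose c2 := p1 * q - p * q1; pose dl := p1 * q2 - p2 * q1.
  have [] := elim AB (fun k => 1 * (c1 * x1 k + c2 * x2 k) + (- dl) * x k)
     (fun k => 1 * (c1 * y1 k + c2 * y2 k) + (- dl) * y k) cA cAB.
  - by move=> k kA; rewrite xA1 // xA2 // xA //; ring.
  - by move=> k kB; rewrite yB1 // yB2 // yB //; ring.
  - by apply: solves_lin => //; apply: solves_lin.
  - by rewrite !expsum_lin -/p -/p1 -/p2 /c1 /c2 /dl; ring.
  - by rewrite !expsum_lin -/q -/q1 -/q2 /c1 /c2 /dl; ring.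
  rewrite !expsum_lin e1 e2 e e1' e2' e' => f1 f2.
  have g1 : c1 * p1 * (v1 - v) + c2 * p2 * (v2 - v) = 0 by rewrite -f1 /c1 /c2 /dl; ring.
  have g2 : c1 * q1 * (U1 - U) + c2 * q2 * (U2 - U) = 0 by rewrite -f2 /c1 /c2 /dl; ring.
  apply/eqP; rewrite -subr_eq0.
  set D := p1 * q2 * (v1 - v) * (U2 - U) - p2 * q1 * (v2 - v) * (U1 - U).
  have D1 : c1 * D = 0.
    transitivity (q2 * (U2 - U) * (c1 * p1 * (v1 - v) + c2 * p2 * (v2 - v)) -
      p2 * (v2 - v) * (c1 * q1 * (U1 - U) + c2 * q2 * (U2 - U))); first by rewrite /D; ring.
    by rewrite g1 g2; ring.
  have D2 : c2 * D = 0.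
    transitivity (p1 * (v1 - v) * (c1 * q1 * (U1 - U) + c2 * q2 * (U2 - U)) -
      q1 * (U1 - U) * (c1 * p1 * (v1 - v) + c2 * p2 * (v2 - v))); first by rewrite /D; ring.
    by rewrite g1 g2; ring.
  have D0 : D = 0.
    apply/eqP; apply: contraT => Dn.
    have c10 : c1 = 0 by apply: (mulIf Dn); rewrite D1 mul0r.
    have c20 : c2 = 0 by apply: (mulIf Dn); rewrite D2 mul0r.
    have dln : dl != 0 by rewrite subr_eq0.
    have : dl * p = 0 by transitivity (p1 * c1 + p2 * c2); [rewrite /c1 /c2 /dl; ring|rewrite c10 c20; ring].
    have : dl * q = 0 by transitivity (q1 * c1 + q2 * c2); [rewrite /c1 /c2 /dl; ring|rewrite c10 c20; ring].
    by move/eqP; rewrite mulf_eq0 (negPf dln) /= => /eqP q0 /eqP;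
      rewrite mulf_eq0 (negPf dln) /= => /eqP p0; move: yn; rewrite p0 q0 eqxx.
  by apply/eqP; rewrite -D0 /D; ring.
have [[v1 b1]|no] := classic (exists v, bad AB v); last first.
  by exists [::] => v bv; case: no; exists v.
have [cA cAB nv1 [U1 [V1 [x1 [y1 [nU1 nV1 rel1 s1 yn1]]]]]] := b1.
(* When the pairs are proportional, comparison with one bad [v1] forces the value of [y^] at [m] to
   vanish for every other bad [v]. Hence [U = U1], and the Moebius map is constant. *)
have [|L HL] := @linkage_finite _ U1 0 1 0 l ly lx r l0 ly0 r0 rX rY.
  by right; rewrite oner_eq0.
exists (v1 :: L) => v bv; rewrite in_cons; case: eqVneq => //= vv1.
have [_ _ nv [U [V [x [y [nU nV rel s yn]]]]]] := bv.
apply: HL => //; exists U, V; split=> //; rewrite mul0r !addr0 mulr1.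
have pr : expsum X y1 m * expsum X y m.+1 = expsum X y m * expsum X y1 m.+1.
  apply/eqP; apply: contraT => ne; case: H; exists v1, v; split=> //; split=> //.
  by exists U1, x1, y1, U, x, y.
case: s1 => xA1 yB1 sv1 e1 e1'; case: s => xA yB sv e e'.
set p1 := expsum X y1 m in e1 pr yn1; set q1 := expsum X y1 m.+1 in e1' pr yn1.
set p := expsum X y m in e pr yn; set q := expsum X y m.+1 in e' pr yn.
have lin a b : a * p1 + b * p = 0 -> a * q1 + b * q = 0 ->
    a * (v1 * p1) + b * (v * p) = 0 /\ a * (U1 * q1) + b * (U * q) = 0.
  move=> h1 h2.
  have [] := elim AB (fun k => a * x1 k + b * x k) (fun k => a * y1 k + b * y k) cA cAB.
  - by move=> k kA; rewrite xA1 // xA //; ring.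
  - by move=> k kB; rewrite yB1 // yB //; ring.
  - exact: solves_lin.
  - by rewrite expsum_lin.
  - by rewrite expsum_lin.
  by rewrite !expsum_lin e1 e e1' e'.
have vn : v1 - v != 0 by rewrite subr_eq0 eq_sym.
have [f1 f2] : q * (v1 * p1) + (- q1) * (v * p) = 0 /\ q * (U1 * q1) + (- q1) * (U * q) = 0.
  by apply: lin; [rewrite mulrC pr; ring|ring].
have [f3 _] : p * (v1 * p1) + (- p1) * (v * p) = 0 /\ p * (U1 * q1) + (- p1) * (U * q) = 0.
  by apply: lin; [ring|rewrite mulNr pr; ring].
have pp1 : p * p1 = 0.
  by apply: (mulfI vn); rewrite mulr0 -f3; ring.
have qp1 : q * p1 = 0.
  apply: (mulfI vn); rewrite mulr0 -[RHS]f1 mulNr.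
  transitivity (q * (v1 * p1) - v * (p1 * q)); first by ring.
  by rewrite pr; ring.
have p10 : p1 = 0.
  apply/eqP; apply: contraT => n.
  by move: pp1 qp1 yn => /eqP; rewrite mulf_eq0 (negPf n) orbF => -> /eqP;
    rewrite mulf_eq0 (negPf n) orbF => ->.
have q1n : q1 != 0 by move: yn1; rewrite p10 eqxx.
have p0 : p = 0.
  by move: pr; rewrite p10 mul0r => /esym /eqP; rewrite mulf_eq0 (negPf q1n) orbF => /eqP.
have qn : q != 0 by move: yn; rewrite p0 eqxx.
apply: (mulfI (mulf_neq0 qn q1n)); apply/eqP; rewrite -subr_eq0; apply/eqP; rewrite -[RHS]f2; ring.
Qed.

End LastRows.

(** * Extremal roots of unity *)

Section RootsOfUnity.
Local Open Scope ring_scope.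
Variable C : numClosedFieldType.

Lemma exists_argmax (T : eqType) (f : T -> C) (r : seq T) : (forall x, f x \is Num.real) ->
  r != [::] -> exists2 x, x \in r & forall y, y \in r -> f y <= f x.
Proof.
move=> fr; elim: r => // a [|b r] IH _; first by exists a => [|y]; rewrite inE // => /eqP ->.
have [x xr Hx] := IH isT.
have [ax|xa] := real_leP (fr a) (fr x).
  exists x => [|y]; first by rewrite inE xr orbT.
  by rewrite inE => /orP[/eqP -> //|/Hx].
exists a => [|y]; first by rewrite mem_head.
by rewrite inE => /orP[/eqP -> //|/Hx h]; apply: le_trans h (ltW xa).
Qed.

(** For two points of the closed upper half circle with angles [theta >= phi > 0], this is
    [cos (theta - phi) > cos theta]. *)
Lemma rotation_increases (x y a b : C) : x \is Num.real -> a \is Num.real ->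
  x ^+ 2 + y ^+ 2 = 1 -> a ^+ 2 + b ^+ 2 = 1 -> 0 <= y -> 0 <= b -> x <= a -> a < 1 ->
  x < x * a + y * b.
Proof.
move=> xr ar xy ab y0 b0 xa a1; rewrite -subr_gt0.
have -> : x * a + y * b - x = y * b - x * (1 - a) by ring.
have a1' : 0 < 1 - a by rewrite subr_gt0.
rewrite subr_gt0; have [x0|x0] := real_ltP xr (real0 C).
  by apply: lt_le_trans (mulr_ge0 y0 b0); rewrite pmulr_llt0.
have X0 : 0 <= x * (1 - a) by rewrite mulr_ge0 // ltW.
rewrite -(@ltr_pXn2r _ 2) ?nnegrE ?(mulr_ge0 y0 b0) //.
rewrite -subr_gt0.
have -> : (y * b) ^+ 2 - (x * (1 - a)) ^+ 2 = (1 - a) * ((a - x) + (1 - x) * (1 + x + x)).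
  have -> : (y * b) ^+ 2 = (1 - x ^+ 2) * (1 - a ^+ 2).
    by rewrite -{1}xy -ab; ring.
  ring.
apply: mulr_gt0 => //; apply: ltr_wpDl; rewrite ?subr_ge0 //.
apply: mulr_gt0; rewrite ?subr_gt0 ?(le_lt_trans xa) //.
by rewrite -addrA ltr_wpDr ?addr_ge0.
Qed.

Lemma closed_prim_root n : (0 < n)%N -> exists w : C, n.-primitive_root w.
Proof.
move=> n0; have [r Dp] := closed_field_poly_normal ('X^n - 1 : {poly C}).
rewrite (monicP (monicXnsubC 1 n0)) scale1r in Dp.
have rn : all n.-unity_root r by apply/allP => z; rewrite -root_prod_XsubC -Dp.
have ur : uniq r by rewrite -separable_prod_XsubC -Dp separable_Xn_sub_1 // pnatr_eq0 -lt0n.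
have [|z _ pz] := hasP (has_prim_root n0 rn ur _); last by exists z.
by rewrite -ltnS -(size_prod_XsubC r id) -Dp size_XnsubC.
Qed.

Lemma Re2_Im2 (z : C) : `|z| = 1 -> 'Re z ^+ 2 + 'Im z ^+ 2 = 1.
Proof. by move=> h; rewrite -normC2_Re_Im h expr1n. Qed.

Lemma norm_unity (z : C) n : (0 < n)%N -> z ^+ n = 1 -> `|z| = 1.
Proof.
move=> n0 zn; apply/eqP; rewrite -(@pexpr_eq1 _ _ n) ?normr_ge0 //.
by rewrite -normrX zn normr1.
Qed.

Lemma conj_norm1 (z : C) : `|z| = 1 -> z^* = z^-1.
Proof. by move=> h; rewrite invC_norm h expr1n invr1 mul1r. Qed.

Lemma Re_lt1 (z : C) : `|z| = 1 -> z != 1 -> 'Re z < 1.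
Proof.
move=> z1 zn; have h := Re2_Im2 z1.
have le1 : 'Re z <= 1.
  by apply: le_trans (real_ler_norm (Creal_Re z)) _; rewrite -z1; exact: (leif_normC_Re_Creal z).1.
rewrite lt_neqAle le1 andbT; apply: contra zn => /eqP e.
move: h; rewrite e expr1n -[RHS]addr0 => /addrI /eqP; rewrite expf_eq0 /= => /eqP e'.
by rewrite [z]Crect e e' mulr0 addr0.
Qed.

(* Rotating towards 1 by [w] strictly increases the real part, so every root of unity
   reaches 1 by powers of [w]. *)
Lemma extremal_root n : (1 < n)%N -> exists2 w : C, n.-primitive_root w &
  forall v, v ^+ n = 1 -> v != 1 -> 'Re v <= 'Re w.
Proof.
move=> n1; have n0 : (0 < n)%N by apply: ltnW.
have [rho prho] := closed_prim_root n0.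
pose all := [seq rho ^+ i | i <- iota 0 n].
have memall v : v ^+ n = 1 -> v \in all.
  move=> /(prim_rootP prho) [i ->]; apply/mapP; exists (val i) => //.
  by rewrite mem_iota /= add0n ltn_ord.
pose cand := [seq v <- all | (v != 1) && (0 <= 'Im v)].
have unity_all v : v \in all -> v ^+ n = 1.
  by case/mapP => i _ ->; rewrite exprAC (prim_expr_order prho) expr1n.
have conj_unity (v : C) : v ^+ n = 1 -> (v^*) ^+ n = 1.
  by move=> h; rewrite -rmorphXn h rmorph1.
have norm1 (v : C) : v ^+ n = 1 -> `|v| = 1 by apply: norm_unity.
have half v : v ^+ n = 1 -> v != 1 -> 0 <= 'Im v -> v \in cand.
  by move=> vn v1 iv; rewrite mem_filter v1 iv memall.
have rho1 : rho != 1.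
  by rewrite -[rho]expr1 -(prim_order_dvd prho) dvdn1 neq_ltn n1 orbT.
have cand0 : cand != [::].
  apply/eqP => c0; have [i0|i0] := real_leP (real0 C) (Creal_Im rho).
    by have := half _ (prim_expr_order prho) rho1 i0; rewrite c0.
  have := half rho^*; rewrite conj_unity ?prim_expr_order // Im_conj oppr_ge0 (ltW i0) c0.
  by rewrite fmorph_eq1 rho1 => /(_ erefl isT isT).
have [w wc Hw] := exists_argmax (fun v => Creal_Re v) cand0.
move: wc; rewrite mem_filter => /andP[/andP[w1 iw] /unity_all wn].
have maxw v : v ^+ n = 1 -> v != 1 -> 'Re v <= 'Re w.
  move=> vn v1; have [i0|i0] := real_leP (real0 C) (Creal_Im v); first exact/Hw/half.
  rewrite -Re_conj; apply/Hw/half; rewrite ?conj_unity ?fmorph_eq1 //.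
  by rewrite Im_conj oppr_ge0 ltW.
exists w => //.
(* A point of largest real part in the orbit of [rho] under [w] must be 1: otherwise a rotation by
   [w] or by its inverse stays in the orbit and increases the real part. Hence [rho] is a power of
   [w]. *)
pose orbit := [seq rho * w ^+ i | i <- iota 0 n].
have wmod k : w ^+ k = w ^+ (k %% n) by rewrite {1}(divn_eq k n) exprD mulnC exprM wn expr1n mul1r.
have orbit_mem k : rho * w ^+ k \in orbit.
  by apply/mapP; exists (k %% n)%N; rewrite -?wmod // mem_iota /= add0n ltn_mod.
have [|v vo Hv] := exists_argmax (fun v => Creal_Re v) (r := orbit).
  by apply/eqP => o0; have := orbit_mem 0%N; rewrite o0.
have [k ek] : exists k, v = rho * w ^+ k by case/mapP: vo => k _ ->; exists k.
have vn : v ^+ n = 1 by rewrite ek exprMn prim_expr_order // exprAC wn expr1n mulr1.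
have v1 : v = 1.
  apply/eqP; apply: contraT => v1.
  have rv := maxw v vn v1; have w1' := Re_lt1 (norm1 w wn) w1.
  have winv : w^* = w ^+ n.-1.
    rewrite conj_norm1 ?norm1 //; apply: (mulfI (_ : w != 0)).
      by rewrite -normr_eq0 norm1 // oner_eq0.
    by rewrite -exprS prednK // wn divff // -normr_eq0 norm1 // oner_eq0.
  have [i0|i0] := real_leP (real0 C) (Creal_Im v).
    have := rotation_increases (Creal_Re v) (Creal_Re w) (Re2_Im2 (norm1 v vn))
      (Re2_Im2 (norm1 w wn)) i0 iw rv w1'.
    suff : 'Re (v * w^*) <= 'Re v by rewrite ReM Re_conj Im_conj mulrN opprK => /le_gtF ->.
    by apply: Hv; rewrite winv ek -mulrA -exprD.
  have := rotation_increases (Creal_Re v^*) (Creal_Re w) (Re2_Im2 (norm1 _ (conj_unity _ vn)))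
      (Re2_Im2 (norm1 w wn)).
  rewrite Re_conj Im_conj oppr_ge0 (ltW i0) => /(_ isT iw rv w1').
  suff : 'Re (v * w) <= 'Re v by rewrite ReM mulNr => /le_gtF ->.
  by apply: Hv; rewrite ek -mulrA -exprSr.
have [m pm mn] := prim_order_exists n0 wn.
suff nm : (n %| m)%N by have /eqP <- : m == n by rewrite eqn_dvd mn nm.
rewrite (prim_order_dvd prho).
have : (rho * w ^+ k) ^+ m = 1 by rewrite -ek v1 expr1n.
by rewrite exprMn exprAC (prim_expr_order pm) expr1n mulr1 => ->.
Qed.

(** On the unit circle such a product is a trigonometric polynomial. Replacing negative powers of
    [z] by their conjugates makes it the real part of a polynomial whose degree is at most the
    number of factors. *)
Lemma Re_prod (r : seq (C * C)) : exists2 g : {poly C}, (size g <= (size r).+1)%N &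
  forall z : C, `|z| = 1 -> 'Re g.[z] = \prod_(ca <- r) 'Re (ca.1 + ca.2 * z).
Proof.
elim: r => [|[c a] r [g sg Hg]].
  by exists 1 => [|z _]; rewrite ?size_poly1 // big_nil hornerC; apply/Creal_ReP; rewrite rpred1.
pose g1 := \poly_(i < (size r)) g`_i.+1.
have eg : g = (g`_0)%:P + 'X * g1.
  apply/polyP => -[|i]; rewrite coefD coefC coefXM /= ?addr0 ?add0r // coef_poly.
  by case: ltnP => // ri; rewrite nth_default // (leq_trans sg).
(* With [A = c + a z], the product of [Re A] and [Re g] is half the real part of [A g] plus the
   conjugate of [A] times [g]. The only negative power left is a multiple of [1 / z], and it is
   replaced by its conjugate. *)
exists (2^-1 *: ((c%:P + a *: 'X) * g + (c^*) *: g + (a^*) *: g1 + (a * (g`_0)^*) *: 'X)).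
  apply: leq_trans (size_scale_leq _ _) _ => /=.
  have szX : (size ('X : {poly C}) <= (size r).+2)%N by rewrite size_polyX.
  do ![apply: leq_trans (size_polyD _ _) _; rewrite geq_max; apply/andP; split].
  - apply: leq_trans (size_polyMleq _ _) _.
    suff : (size (c%:P + a *: 'X)%R <= 2)%N by move: sg; lia.
    apply: leq_trans (size_polyD _ _) _; rewrite geq_max (leq_trans (size_polyC_leq1 _)) //.
    by apply: leq_trans (size_scale_leq _ _) _; rewrite size_polyX.
  - by apply: leq_trans (size_scale_leq _ _) _; apply: leqW.
  - by apply: leq_trans (size_scale_leq _ _) _; apply: leq_trans (size_poly _ _) _; lia.
  - exact: leq_trans (size_scale_leq _ _) _.
move=> z z1; rewrite big_cons -Hg //= !(hornerZ, hornerD, hornerM, hornerC, hornerX).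
have := congr1 (fun p : {poly C} => p.[z]) eg; rewrite hornerD hornerM hornerC hornerX => e.
have zc : z * z^* = 1 by apply: norm1_conj.
rewrite !ReE; set G := g.[z] in e *; set H := g1.[z] in e *; set g0 := g`_0 in e *.
have zz : z^* = z^-1 by apply: conj_norm1.
have z0 : z != 0 by rewrite -normr_eq0 z1 oner_eq0.
have eH : H = (G - g0) / z by rewrite e addrAC subrr add0r mulrAC divff ?mul1r.
clearbody H G g0; rewrite eH.
rewrite !(rmorphM, rmorphD, rmorphN, fmorphV, rmorph1) /= !conjCK zz invrK.
by field; rewrite z0 ?pnatr_eq0.
Qed.

End RootsOfUnity.

(** * Interpolation at roots of unity *)

Section Positivity.
Local Open Scope ring_scope.
Variables (C : numClosedFieldType) (n : nat) (w : C).
Hypothesis pw : n.-primitive_root w.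
Hypothesis extw : forall v, v ^+ n = 1 -> v != 1 -> 'Re v <= 'Re w.

Lemma prim_norm k : `|w ^+ k| = 1.
Proof.
apply: (norm_unity (prim_order_gt0 pw)).
by rewrite exprAC (prim_expr_order pw) expr1n.
Qed.

Lemma prim_neq0 k : w ^+ k != 0.
Proof. by rewrite -normr_eq0 prim_norm oner_eq0. Qed.

Lemma prim_inj i j : (i < n)%N -> (j < n)%N -> w ^+ i = w ^+ j -> i = j.
Proof.
move=> hi hj /eqP; rewrite (eq_prim_root_expr pw).
by rewrite /= !modn_small // => /eqP.
Qed.

(** The factor equals [1] minus the real part of [w^(k-j)], plus the real part of [w^(j'-j)] minus
    that of [w^(k-j')]. Extremality of [w] makes the second difference nonnegative for [k] other
    than [j] and [j'], and at the two nodes the differences cancel. *)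
Lemma factor_pos j j' k : (1 < n)%N -> (j <= j' <= j.+1)%N -> (j' < n)%N -> (k < n)%N ->
  let F := 'Re (1 + 'Re (w ^+ (j' - j)) + - ((w ^+ j)^* + (w ^+ j')^*) * w ^+ k) in
  if (k == j) || (k == j') then F == 0 else 0 < F.
Proof.
move=> n1 /andP[jj' j'j] j'n kn /=.
have w1 : w != 1 by rewrite -[w]expr1 -(prim_order_dvd pw) dvdn1 neq_ltn n1 orbT.
have wlt : 'Re w < 1 by apply: Re_lt1 w1; rewrite -[w]expr1 prim_norm.
have -> : 'Re (1 + 'Re (w ^+ (j' - j)) + - ((w ^+ j)^* + (w ^+ j')^*) * w ^+ k) =
  (1 - 'Re (w ^+ k * (w ^+ j)^*)) + ('Re (w ^+ (j' - j)) - 'Re (w ^+ k * (w ^+ j')^*)).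
  rewrite mulNr mulrDl !['Re (_ + _)]raddfD /= ['Re (- _)]raddfN /= ['Re (_ + _)]raddfD /=.
  rewrite (Creal_ReP _ (Creal_Re _)) (Creal_ReP 1 _) ?rpred1 //.
  by rewrite ![_ * w ^+ k]mulrC; ring.
have wj i : w ^+ i * (w ^+ i)^* = 1 by apply: norm1_conj; apply: prim_norm.
have bnd i : (i < n)%N -> k != i -> 'Re (w ^+ k * (w ^+ i)^*) <= 'Re w.
  move=> hi ki; apply: extw.
    rewrite exprMn -rmorphXn /= -!exprM ![(_ * n)%N]mulnC !exprM (prim_expr_order pw).
    by rewrite !expr1n rmorph1 mulr1.
  apply: contra ki => /eqP e; apply/eqP/(prim_inj kn hi).
  by rewrite -[LHS]mulr1 -(wj i) mulrCA e mulr1.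
have [->|kj] := eqVneq k j.
  have -> : w ^+ j * (w ^+ j')^* = (w ^+ (j' - j))^*.
    by rewrite -{1}(subnKC jj') exprD rmorphM mulrA wj mul1r.
  by rewrite /= wj Re_conj (Creal_ReP 1 _) ?rpred1 // subrr add0r subrr.
have [->|kj'] /= := eqVneq k j'.
  have -> : w ^+ j' * (w ^+ j)^* = w ^+ (j' - j).
    by rewrite -{1}(subnKC jj') exprD mulrAC wj mul1r.
  by rewrite wj (Creal_ReP 1 _) ?rpred1 //; apply/eqP; ring.
have h1 : 'Re (w ^+ k * (w ^+ j)^*) < 1 by apply: le_lt_trans wlt; apply: bnd => //; lia.
have h2 : 'Re (w ^+ k * (w ^+ j')^*) <= 'Re (w ^+ (j' - j)).
  apply: le_trans (bnd _ j'n kj') _; have [->|] := eqVneq j' j.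
    by rewrite subnn expr0 (Creal_ReP 1 _) ?rpred1 // ltW.
  by move=> ne; have -> : (j' - j = 1)%N by move: ne; lia.
by apply: ltr_wpDr; rewrite ?subr_ge0 ?subr_gt0.
Qed.

Lemma exists_positive s : (0 < s < n)%N ->
  exists g : {poly C}, [/\ (size g <= s./2.+2)%N, forall j, (j <= s)%N -> 'Re g.[w ^+ j] = 0 &
    forall j, (s < j < n)%N -> 0 < 'Re g.[w ^+ j]].
Proof.
move=> /andP[s0 sn]; have n1 : (1 < n)%N by lia.
(* The nodes [0 .. s] are covered by consecutive pairs, with one factor for each pair; for even [s]
   the last pair collapses to the node [s]. The size of [g] is then at most [s] as soon as
   [s >= 3]. *)
pose j' i := minn i.*2.+1 s.
pose fac i := (1 + 'Re (w ^+ (j' i - i.*2)), - ((w ^+ i.*2)^* + (w ^+ (j' i))^*)).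
have [g sg Hg] := Re_prod [seq fac i | i <- iota 0 s./2.+1].
have F i k : (i < s./2.+1)%N -> (k < n)%N ->
  if (k == i.*2) || (k == j' i) then 'Re ((fac i).1 + (fac i).2 * w ^+ k) == 0
  else 0 < 'Re ((fac i).1 + (fac i).2 * w ^+ k).
  by move=> hi kn; apply: factor_pos => //; rewrite /j'; lia.
exists g; split; first by move: sg; rewrite size_map size_iota.
- move=> j js; rewrite Hg ?prim_norm // big_map; apply/eqP; rewrite prodf_seq_eq0.
  apply/hasP; exists j./2; first by rewrite mem_iota /=; lia.
  have := F j./2 j; rewrite ifT; last by rewrite /j'; lia.
  by apply; lia.
- move=> j /andP[sj jn]; rewrite Hg ?prim_norm // big_map big_seq.
  apply: prodr_gt0 => i; rewrite mem_iota /= add0n => hi.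
  have := F i j hi jn; rewrite ifF //; rewrite /j'; lia.
Qed.

End Positivity.

Section Interpolation.
Local Open Scope ring_scope.
Variables (C : fieldType) (z : nat -> C) (s : nat).
Hypothesis z_inj : forall i j, (i <= s)%N -> (j <= s)%N -> z i = z j -> i = j.

(** These are the barycentric weights of the nodes, that is, the coefficients of the divided
    difference of order [s]. *)
Definition bary j := (\prod_(i < s.+1 | i != j :> nat) (z j - z i))^-1.
Definition lagr j := bary j *: \prod_(i < s.+1 | i != j :> nat) ('X - (z i)%:P).
Definition interp (u : nat -> C) := \sum_(j < s.+1) u j *: lagr j.

Lemma bary_neq0 j : (j <= s)%N -> bary j != 0.
Proof.
move=> js; rewrite invr_eq0; apply/prodf_neq0 => i ij; rewrite subr_eq0.
by apply: contra ij => /eqP /z_inj ->//; rewrite -ltnS.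
Qed.

Lemma lagr_eval j i : (j <= s)%N -> (i <= s)%N -> (lagr j).[z i] = (i == j)%:R.
Proof.
move=> js si; rewrite hornerZ horner_prod.
under eq_bigr do rewrite hornerXsubC.
have [->|ij] := eqVneq i j.
  rewrite /bary mulVf //; have := bary_neq0 js; by rewrite invr_eq0.
rewrite (bigD1 (Ordinal (si : (i < s.+1)%N))) //= subrr mul0r mulr0 //.
Qed.

Lemma lagr_coef j : (j <= s)%N -> (size (lagr j) <= s.+1)%N /\ (lagr j)`_s = bary j.
Proof.
move=> js; pose P := \prod_(i < s.+1 | i != j :> nat) ('X - (z i)%:P).
have sP : size P = s.+1.
  rewrite /P -big_enum size_prod_XsubC -cardE.
  rewrite (eq_card (B := predC1 (Ordinal (js : (j < s.+1)%N)))); last by move=> i; rewrite !inE.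
  by have := cardC1 (Ordinal (js : (j < s.+1)%N)); rewrite card_ord => ->.
split; first by apply: leq_trans (size_scale_leq _ _) _; rewrite -/P sP.
rewrite coefZ -/P; have -> : P`_s = lead_coef P by rewrite lead_coefE sP.
by rewrite (monicP _) ?mulr1 //; apply: monic_prod => i _; apply: monicXsubC.
Qed.

Lemma interp_eval u i : (i <= s)%N -> (interp u).[z i] = u i.
Proof.
move=> si; rewrite horner_sum (bigD1 (Ordinal (si : (i < s.+1)%N))) //=.
rewrite hornerZ lagr_eval // eqxx mulr1 big1 ?addr0 // => j ji.
rewrite hornerZ lagr_eval ?(ltnSE (ltn_ord j)) // (_ : (i == j) = false) ?mulr0 //.
by apply/negP => /eqP e; case/negP: ji; apply/eqP/val_inj.
Qed.

Lemma interp_coef u : (size (interp u) <= s.+1)%N /\ (interp u)`_s = \sum_(j < s.+1) bary j * u j.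
Proof.
split.
  apply: leq_trans (size_sum _ _ _) _; apply/bigmax_leqP => j _.
  by apply: leq_trans (size_scale_leq _ _) _; case: (lagr_coef (ltnSE (ltn_ord j))).
rewrite coef_sum; apply: eq_bigr => j _; rewrite coefZ mulrC.
by case: (lagr_coef (ltnSE (ltn_ord j))) => _ ->.
Qed.

(** The weighted sum is the coefficient of degree [s], so its vanishing is the one linear condition
    on [s.+1] values that leaves an interpolant with [s] coefficients. *)
Lemma interp_size (u : nat -> C) : \sum_(j < s.+1) bary j * u j = 0 -> (size (interp u) <= s)%N.
Proof.
have [h1 h2] := interp_coef u => h; rewrite -ltnS leq_eqVlt in h1.
rewrite -ltnS; case/orP: h1 => //; rewrite eqSS => /eqP h1.
have : lead_coef (interp u) = 0 by rewrite lead_coefE h1 h2.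
by move/eqP; rewrite lead_coef_eq0 => /eqP ->; rewrite size_poly0.
Qed.

Lemma interp_unique (p : {poly C}) : (size p <= s.+1)%N -> p = interp (fun j => p.[z j]).
Proof.
move=> sp; apply/eqP; rewrite -subr_eq0; apply/eqP.
apply: (@roots_geq_poly_eq0 _ _ [seq z j | j <- iota 0 s.+1]).
- apply/allP => x /mapP[j]; rewrite mem_iota add0n ltnS => /= js ->.
  by rewrite /root hornerD hornerN interp_eval // subrr.
- rewrite map_inj_in_uniq ?iota_uniq // => i j; rewrite !mem_iota !add0n !ltnS /=.
  exact: z_inj.
rewrite size_map size_iota; apply: leq_trans (size_polyD _ _) _.
by rewrite size_polyN geq_max sp; case: (interp_coef (fun j => p.[z j])).
Qed.

Lemma bary_sum (p : {poly C}) : (size p <= s)%N -> \sum_(j < s.+1) bary j * p.[z j] = 0.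
Proof.
move=> sp; rewrite -(proj2 (interp_coef (fun j => p.[z j]))) -interp_unique.
  by rewrite nth_default.
exact: leqW.
Qed.

End Interpolation.

Section GeometricNodes.
Local Open Scope ring_scope.
Variables (C : numClosedFieldType) (n : nat) (w : C).
Hypothesis pw : n.-primitive_root w.

(** After multiplication by [w ^+ m], both sides are the product of [w ^+ m.+1 - w ^+ i] over
    [i <= m], split at its last and at its first factor. *)
Lemma geom_prod_ratio m : w != 0 ->
  (\prod_(i < m) (w ^+ m.+1 - w ^+ i)) * (w - 1) = (w ^+ m.+1 - 1) * (\prod_(i < m) (w ^+ m - w ^+ i)).
Proof.
move=> w0; apply: (mulIf (expf_neq0 m w0)).
have e1 : \prod_(i < m.+1) (w ^+ m.+1 - w ^+ i) =
    (\prod_(i < m) (w ^+ m.+1 - w ^+ i)) * (w - 1) * w ^+ m.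
  by rewrite big_ord_recr /= -mulrA; congr (_ * _); rewrite exprS; ring.
rewrite -e1 big_ord_recl expr0 -mulrA; congr (_ * _).
transitivity (\prod_(i < m) ((w ^+ m - w ^+ i) * w)).
  by apply: eq_bigr => i _; rewrite lift0 !exprS; ring.
by rewrite big_split /= prodr_const card_ord.
Qed.

(* [a^* b - a b^* != 0] says that [a] and [b] are linearly independent over the reals. *)
Lemma bary_nonparallel m : (m.+1 < n)%N -> (0 < m)%N ->
  (bary (GRing.exp w) m.+1 m)^* * bary (GRing.exp w) m.+1 m.+1 -
  bary (GRing.exp w) m.+1 m * (bary (GRing.exp w) m.+1 m.+1)^* != 0.
Proof.
move=> mn m0; set b := bary _ _.
have w0 : w != 0 by rewrite -[w]expr1 (prim_neq0 pw).
have inj : forall i j, (i <= m.+1)%N -> (j <= m.+1)%N -> w ^+ i = w ^+ j -> i = j.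
  by move=> i j hi hj; apply: (prim_inj pw); lia.
have b0 : b m != 0 := bary_neq0 inj (leqnSn m); have b1 : b m.+1 != 0 := bary_neq0 inj (leqnn m.+1).
have em : (b m)^-1 = (\prod_(i < m) (w ^+ m - w ^+ i)) * (w ^+ m - w ^+ m.+1).
  rewrite /b /bary invrK big_mkcond big_ord_recr big_ord_recr /= eqxx mulr1.
  rewrite ifT; last by lia.
  by congr (_ * _); apply: eq_bigr => i _; rewrite ifT //; have := ltn_ord i; lia.
have eM : (b m.+1)^-1 = (\prod_(i < m) (w ^+ m.+1 - w ^+ i)) * (w ^+ m.+1 - w ^+ m).
  rewrite /b /bary invrK big_mkcond big_ord_recr big_ord_recr /= eqxx mulr1.
  rewrite ifT; last by lia.
  by congr (_ * _); apply: eq_bigr => i _; rewrite ifT //; have := ltn_ord i; lia.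
clearbody b; have w1 : w - 1 != 0.
  rewrite subr_eq0 -[w]expr1 -(expr0 w); apply/eqP => /(prim_inj pw); lia.
have wm1 : w ^+ m.+1 - 1 != 0.
  rewrite subr_eq0 -(expr0 w); apply/eqP => /(prim_inj pw); lia.
(* The ratio of the two weights is explicit. If it were real, conjugation would give [e], which
   clears to [(w - 1) (w^(m+1) - 1) (w^(m+1) - w) = 0]. *)
have rat : b m.+1 * (w ^+ m.+1 - 1) = - (b m * (w - 1)).
  have : (b m.+1)^-1 * (w - 1) = - ((b m)^-1 * (w ^+ m.+1 - 1)).
    transitivity ((\prod_(i < m) (w ^+ m.+1 - w ^+ i)) * (w - 1) * (w ^+ m.+1 - w ^+ m)).
      by rewrite eM; ring.
    by rewrite geom_prod_ratio // em; ring.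
  move=> e; apply: (mulfI (mulf_neq0 (invr_neq0 b0) (invr_neq0 b1))).
  move: (w ^+ m.+1) e => W e.
  transitivity ((b m)^-1 * (W - 1)); first by field; rewrite b0 b1.
  by rewrite -[LHS]opprK -e; field; rewrite b0 b1.
apply/negP; rewrite subr_eq0 => /eqP h.
have ratc := congr1 (fun x => x^*) rat.
rewrite rmorphN !rmorphM !rmorphB rmorph1 /= in ratc.
have nb : b m * (b m)^* != 0 by rewrite normCK_eq0.
have e : (w - 1) * ((w ^+ m.+1)^* - 1) = (w^* - 1) * (w ^+ m.+1 - 1).
  apply: (mulfI nb).
  transitivity (- ((b m)^* * (- (b m * (w - 1))) * ((w ^+ m.+1)^* - 1))); first by ring.
  rewrite -rat.
  transitivity (- ((b m)^* * b m.+1 * ((w ^+ m.+1)^* - 1) * (w ^+ m.+1 - 1))); first by ring.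
  rewrite h.
  transitivity (- (b m * ((b m.+1)^* * ((w ^+ m.+1)^* - 1)) * (w ^+ m.+1 - 1))); first by ring.
  by rewrite ratc; ring.
rewrite !conj_norm1 ?(prim_norm pw) // in e; last by rewrite -[w]expr1 (prim_norm pw).
have W0 := prim_neq0 pw m.+1.
have : (w - 1) * (w ^+ m.+1 - 1) * (w ^+ m.+1 - w) = 0.
  transitivity (w * w ^+ m.+1 * ((w - 1) * ((w ^+ m.+1)^-1 - 1) - (w^-1 - 1) * (w ^+ m.+1 - 1))).
    set W := w ^+ m.+1 in W0 *; clearbody W; field; by rewrite w0 W0.
  by rewrite e subrr mulr0.
move/eqP; rewrite !mulf_eq0 (negPf w1) (negPf wm1) /= subr_eq0 -{2}[w]expr1 => /eqP /(prim_inj pw).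
by move=> /(_ mn) ; lia.
Qed.

End GeometricNodes.

(** * Small parameters *)

Section SmallParameter.
Local Open Scope ring_scope.
Variables (C : numClosedFieldType) (I : Type) (eps : I -> C).
Hypothesis eps_gt0 : forall i, 0 < eps i.
Hypothesis eps_le1 : forall i, eps i <= 1.
Implicit Types (f g : I -> C) (P Q : I -> Prop).

(** The variable is an index [i] rather than [eps i] itself, so that bounds are uniform over all
    indices with the same small parameter. *)
Definition eventually P := exists2 e : C, 0 < e & forall i, eps i < e -> P i.

Definition bigO (k : nat) f :=
  exists2 K : C, 0 <= K & eventually (fun i => `|f i| <= K * eps i ^+ k).

Lemma eventually_and P Q : eventually P -> eventually Q -> eventually (fun i => P i /\ Q i).
Proof.
move=> [e e0 He] [e' e'0 He'].
have [ee'|e'e] := real_leP (gtr0_real e0) (gtr0_real e'0).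
  by exists e => // i ie; split; [exact: He|apply/He'/(lt_le_trans ie)].
by exists e' => // i ie; split; [apply/He/(lt_trans ie)|exact: He'].
Qed.

Lemma eventually_sub P Q : (forall i, P i -> Q i) -> eventually P -> eventually Q.
Proof. by move=> PQ [e e0 He]; exists e => // i /He/PQ. Qed.

Lemma eventually_all m (P : nat -> I -> Prop) : (forall j, (j < m)%N -> eventually (P j)) ->
  eventually (fun i => forall j, (j < m)%N -> P j i).
Proof.
elim: m => [|m IH] h; first by exists 1.
have h1 := h m (ltnSn m); have h2 : eventually (fun i => forall j, (j < m)%N -> P j i).
  by apply: IH => j jm; apply: h; apply: ltnW.
apply: eventually_sub (eventually_and h1 h2) => i [Pm Pj] j.
by rewrite ltnS leq_eqVlt => /orP[/eqP ->|/Pj].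
Qed.

Lemma bigO_ev k f g : eventually (fun i => f i = g i) -> bigO k f -> bigO k g.
Proof.
move=> h [K K0 HK]; exists K => //.
by apply: eventually_sub (eventually_and h HK) => i [->].
Qed.

Lemma bigO_eq k f g : (forall i, f i = g i) -> bigO k f -> bigO k g.
Proof. by move=> h; apply: bigO_ev; exists 1. Qed.

Lemma bigO_le k f g : eventually (fun i => `|g i| <= `|f i|) -> bigO k f -> bigO k g.
Proof.
move=> h [K K0 HK]; exists K => //.
by apply: eventually_sub (eventually_and h HK) => i [h1]; apply: le_trans.
Qed.

Lemma bigOD k f g : bigO k f -> bigO k g -> bigO k (fun i => f i + g i).
Proof.
move=> [K K0 HK] [K' K'0 HK']; exists (K + K'); first exact: addr_ge0.
apply: eventually_sub (eventually_and HK HK') => i [h h'].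
by apply: le_trans (ler_normD _ _) _; rewrite mulrDl lerD.
Qed.

Lemma bigON k f : bigO k f -> bigO k (fun i => - f i).
Proof. by apply: bigO_le; exists 1 => // i _; rewrite normrN. Qed.

Lemma bigOB k f g : bigO k f -> bigO k g -> bigO k (fun i => f i - g i).
Proof. by move=> hf hg; apply: bigOD => //; apply: bigON. Qed.

Lemma bigOM k l f g : bigO k f -> bigO l g -> bigO (k + l) (fun i => f i * g i).
Proof.
move=> [K K0 HK] [K' K'0 HK']; exists (K * K'); first exact: mulr_ge0.
apply: eventually_sub (eventually_and HK HK') => i [h h'].
by rewrite normrM exprD mulrACA ler_pM.
Qed.

Lemma bigO_cst c : bigO 0 (fun=> c).
Proof. by exists `|c| => //; exists 1 => // i _; rewrite mulr1. Qed.

Lemma bigOZ k c f : bigO k f -> bigO k (fun i => c * f i).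
Proof. by move=> hf; apply: (bigOM (bigO_cst c) hf). Qed.

Lemma bigO_conj k f : bigO k f -> bigO k (fun i => (f i)^*).
Proof. by apply: bigO_le; exists 1 => // i _; rewrite norm_conjC. Qed.

Lemma bigO_weak k l f : (l <= k)%N -> bigO k f -> bigO l f.
Proof.
move=> lk [K K0 HK]; exists K => //; apply: eventually_sub HK => i h.
apply: le_trans h _; apply: ler_wpM2l => //; rewrite -(subnKC lk) exprD.
by rewrite ler_piMr ?exprn_ge0 ?exprn_ile1 // ltW.
Qed.

Lemma bigO_sum k m (F : nat -> I -> C) : (forall j, (j < m)%N -> bigO k (F j)) ->
  bigO k (fun i => \sum_(j < m) F j i).
Proof.
elim: m => [|m IH] h.
  by exists 0 => //; exists 1 => // i _; rewrite big_ord0 normr0 mul0r.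
apply: (@bigO_eq _ (fun i => \sum_(j < m) F j i + F m i)).
  by move=> i; rewrite big_ord_recr.
by apply: bigOD; [apply: IH => j jm; apply/h/ltnW|apply: h].
Qed.

Lemma bigO_eps : bigO 1 eps.
Proof. by exists 1 => //; exists 1 => // i _; rewrite gtr0_norm // mul1r expr1. Qed.

Lemma bigO_dominated k f c : 0 < c -> bigO k.+1 f ->
  eventually (fun i => `|f i| < c * eps i ^+ k).
Proof.
move=> c0 [K K0 HK].
have K1 : 0 < K + 1 by apply: ltr_wpDl.
have small : eventually (fun i => eps i < c / (K + 1)).
  by exists (c / (K + 1)) => //; apply: divr_gt0.
apply: eventually_sub (eventually_and HK small) => i [h1 h2].
apply: le_lt_trans h1 _; rewrite exprS mulrA ltr_pM2r ?exprn_gt0 //.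
rewrite ltr_pdivlMr // in h2; apply: le_lt_trans h2; rewrite mulrC.
by apply: ler_wpM2l; rewrite ?lerDl // ltW.
Qed.

Lemma bigO_inv f c : c != 0 -> bigO 1 (fun i => f i - c) ->
  eventually (fun i => f i != 0) /\ bigO 0 (fun i => (f i)^-1).
Proof.
move=> c0 h; have c0' : 0 < `|c| / 2 by rewrite divr_gt0 ?normr_gt0.
have big : eventually (fun i => `|c| / 2 <= `|f i|).
  apply: eventually_sub (bigO_dominated c0' h) => i; rewrite expr0 mulr1 => hi.
  have := lerB_dist c (c - f i); rewrite subKr (distrC c); apply: le_trans.
  rewrite lerBrDr -[leRHS](subrK (`|c| / 2)) [X in _ <= X - _ + _](_ : `|c| = `|c| / 2 + `|c| / 2).
    by rewrite addrK lerD2l ltW.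
  by field.
split; first by apply: eventually_sub big => i hi; rewrite -normr_gt0; apply: lt_le_trans hi.
exists (`|c| / 2)^-1; first by rewrite invr_ge0 ltW.
apply: eventually_sub big => i hi; rewrite mulr1 normfV lef_pV2 // posrE //.
exact: lt_le_trans hi.
Qed.

(** A triangle with side lengths [|a|], [|b|], [|c i|] has to be closed up. At [c i = a + b] it is
    nondegenerate by the first hypothesis, so a nearby third side still gives a triangle, and the
    rotations of the two other sides are of first order. *)
Lemma triangle (a b : C) (c : I -> C) :
  a^* * b - a * b^* != 0 -> bigO 1 (fun i => c i - (a + b)) ->
  exists U V : I -> C, [/\ eventually (fun i => [/\ `|U i| = 1, `|V i| = 1 & a * U i + b * V i = c i]),
    bigO 1 (fun i => U i - 1) & bigO 1 (fun i => V i - 1)].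
Proof.
set Dl := _ - _ => Dl0 hc.
have a0 : a != 0 by apply: contraNneq Dl0 => a0; rewrite /Dl a0 conjC0 !mul0r subrr.
have b0 : b != 0 by apply: contraNneq Dl0 => b0; rewrite /Dl b0 conjC0 !mulr0 subrr.
pose c0 := a + b.
have c00 : c0 != 0.
  apply: contraNneq Dl0 => /eqP; rewrite addr_eq0 => /eqP e.
  by rewrite /Dl e rmorphN mulNr mulNr mulrC subrr.
have cDl : Dl^* = - Dl by rewrite /Dl rmorphB !rmorphM /= !conjCK; ring.
have iDl : ('i * Dl)^* = 'i * Dl by rewrite rmorphM /= conjCi cDl mulrNN.
pose X := b * b^*; pose Y := a * a^*.
pose R i := c i * (c i)^*; pose R0 := c0 * c0^*.
(* By Heron's formula [D i] is sixteen times the squared area of the triangle. *)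
pose D i := 4 * X * Y - (R i - X - Y) ^+ 2.
pose D0 := ('i * Dl) ^+ 2.
have eD0 : D0 = 4 * X * Y - (R0 - X - Y) ^+ 2.
  rewrite /D0 exprMn sqrCi /Dl /X /Y /R0 /c0 rmorphD /=; ring.
have D0_gt0 : 0 < D0.
  rewrite /D0 real_exprn_even_gt0 //=; last by apply/CrealP.
  by rewrite mulf_neq0 ?neq0Ci.
(* Since [Dl] is purely imaginary, [sg] is a sign; it selects the orientation for which [U] is 1 at
   [c0]. *)
pose sg := 'i * Dl / sqrtC D0.
have sD0 : 0 < sqrtC D0 by rewrite sqrtC_gt0.
have sg2 : sg ^+ 2 = 1 by rewrite /sg expr_div_n sqrtCK divff // gt_eqF.
have sgr : sg^* = sg.
  by rewrite /sg rmorphM /= iDl fmorphV /= (CrealP (gtr0_real sD0)).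
pose de i := sg * sqrtC (D i).
(* The law of cosines gives the real part of [a U] times the conjugate of [c], and [de] is twice its
   imaginary part. *)
pose U i := ((R i + Y - X) + 'i * de i) / (2 * (c i)^* * a).
pose V i := (c i - a * U i) / b.
have hR : bigO 1 (fun i => R i - R0).
  apply: (@bigO_eq _ (fun i => (c i - c0) * ((c i - c0)^* + c0^*) + c0 * (c i - c0)^*)).
    by move=> i; rewrite /R /R0 rmorphB /=; ring.
  apply: bigOD; last by apply: bigOZ; apply: bigO_conj.
  apply: (bigOM (k := 1) (l := 0) hc); apply: bigOD; last exact: bigO_cst.
  by apply: bigO_conj; apply: bigO_weak hc.
have hD : bigO 1 (fun i => D i - D0).
  apply: (@bigO_eq _ (fun i => (R i - R0) * - ((R i - R0) + 2 * (R0 - X - Y)))).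
    by move=> i; rewrite eD0 /D; ring.
  apply: (bigOM (k := 1) (l := 0) hR); apply: bigON; apply: bigOD; last exact: bigO_cst.
  by apply: bigO_weak hR.
have Dr i : D i \is Num.real.
  by apply/CrealP; rewrite /D /R /X /Y !(rmorphB, rmorphM, rmorphXn) /= !conjCK !rmorph_nat; ring.
have Dpos : eventually (fun i => 0 < D i).
  apply: eventually_sub (bigO_dominated D0_gt0 hD) => i; rewrite expr0 mulr1.
  have r : D i - D0 \is Num.real := realB (Dr i) (gtr0_real D0_gt0).
  by rewrite (real_ltr_distl _ r) subrr => /andP[].
have hde : bigO 1 (fun i => de i - 'i * Dl).
  apply: (@bigO_le _ (fun i => (sg / sqrtC D0) * (D i - D0))); last exact: bigOZ.
  apply: eventually_sub Dpos => i Di.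
  have sDi : 0 < sqrtC (D i) by rewrite sqrtC_gt0.
  have -> : de i - 'i * Dl = sg / (sqrtC (D i) + sqrtC D0) * (D i - D0).
    rewrite -{2}(sqrtCK (D i)) -{2}(sqrtCK D0) subr_sqr /de.
    have -> : 'i * Dl = sg * sqrtC D0 by rewrite /sg mulfVK // gt_eqF.
    by field; rewrite gt_eqF // addr_gt0.
  rewrite !normrM; apply: ler_wpM2r => //; apply: ler_wpM2l; first by rewrite !mulr_ge0.
  rewrite !normfV lef_pV2 ?posrE ?normr_gt0 ?gt_eqF ?addr_gt0 //.
  by rewrite !gtr0_norm ?addr_gt0 // ler_wpDl // ltW.
have [cne cinv] := bigO_inv c00 hc.
have hU : bigO 1 (fun i => U i - 1).
  apply: (@bigO_ev _ (fun i => ((R i - R0) + 'i * (de i - 'i * Dl) - 2 * a * (c i - c0)^*) *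
      ((2 * a)^-1 * ((c i)^-1)^*))).
    apply: eventually_sub cne => i ci.
    have ci' : (c i)^* != 0 by rewrite conjC_eq0.
    have base : R0 + Y - X + 'i * ('i * Dl) - 2 * a * c0^* = 0.
      by rewrite mulrA -expr2 sqrCi /R0 /Y /X /Dl /c0 rmorphD /=; ring.
    rewrite fmorphV /U rmorphB /=.
    have -> : R i - R0 + 'i * (de i - 'i * Dl) - 2 * a * ((c i)^* - c0^*) =
      (R i + Y - X + 'i * de i - 2 * a * (c i)^*) - (R0 + Y - X + 'i * ('i * Dl) - 2 * a * c0^*) by ring.
    by rewrite base subr0; field; rewrite ci' a0.
  apply: (bigOM (k := 1) (l := 0)).
    by apply: bigOB; [apply: bigOD => //; apply: bigOZ|apply: bigOZ; apply: bigO_conj].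
  by apply: bigOZ; apply: bigO_conj.
exists U, V; split=> //; last first.
  apply: (@bigO_eq _ (fun i => b^-1 * ((c i - c0) - a * (U i - 1)))).
    by move=> i; rewrite /V /c0; field.
  by apply: bigOZ; apply: bigOB => //; apply: bigOZ.
apply: eventually_sub (eventually_and cne Dpos) => i [ci Di].
have ci' : (c i)^* != 0 by rewrite conjC_eq0.
have a0' : a^* != 0 by rewrite conjC_eq0.
have b0' : b^* != 0 by rewrite conjC_eq0.
have cR : (R i)^* = R i by rewrite /R rmorphM /= conjCK mulrC.
have cX : X^* = X by rewrite /X rmorphM /= conjCK mulrC.
have cY : Y^* = Y by rewrite /Y rmorphM /= conjCK mulrC.
have cde : (de i)^* = de i.
  by rewrite /de rmorphM /= sgr (CrealP _) // ger0_real // sqrtC_ge0 ltW.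
have de2 : de i ^+ 2 = D i by rewrite /de exprMn sg2 sqrtCK mul1r.
have cU : (U i)^* = (R i + Y - X - 'i * de i) / (2 * c i * a^*).
  have c1 : (R i + Y - X + 'i * de i)^* = R i + Y - X - 'i * de i.
    have ci_de : ('i * de i)^* = - ('i * de i) by rewrite rmorphM /= conjCi cde mulNr.
    by rewrite rmorphD /= ci_de rmorphB /= cX rmorphD /= cR cY.
  have c2 : (2 * (c i)^* * a)^* = 2 * c i * a^*.
    by rewrite !rmorphM /= conjCK rmorph_nat.
  by rewrite /U rmorphM fmorphV /= c1 c2.
have UU : U i * (U i)^* = 1.
  rewrite cU /U.
  transitivity (((R i + Y - X) ^+ 2 + de i ^+ 2) / (4 * R i * Y)).
    rewrite /R /Y; field: (sqrCi C); by rewrite ci ci' a0 a0'.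
  by rewrite de2 /D /R /Y; field; rewrite ci ci' a0 a0'.
have norm1 (z : C) : z * z^* = 1 -> `|z| = 1.
  by rewrite -normCK => /eqP; rewrite sqrp_eq1 // => /eqP.
split; first exact: norm1.
  apply: norm1; rewrite /V rmorphM fmorphV rmorphB rmorphM /=.
  transitivity ((R i - ((c i)^* * a * U i + c i * a^* * (U i)^*) + Y * (U i * (U i)^*)) / X).
    by rewrite /R /X /Y; field; rewrite b0 b0'.
  rewrite UU cU /U.
  transitivity ((R i - (R i + Y - X) + Y * 1) / X).
    by rewrite /X; field; rewrite b0 b0' ci ci' a0 a0'.
  by rewrite /X; field; rewrite b0 b0'.
by rewrite /V; field.
Qed.

End SmallParameter.

(** * Perturbing the constant polynomial 1 *)

Section Perturbation.
Local Open Scope ring_scope.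
Variable C : numClosedFieldType.

Lemma infinite_injective (T : eqType) (S : T -> Prop) (f : nat -> T) :
  injective f -> (forall k, S (f k)) -> infinite S.
Proof.
move=> fi fS L; apply: NNPP => no.
have sub : {subset [seq f k | k <- iota 0 (size L).+1] <= L}.
  by move=> x /mapP[k _ ->]; apply: contraT => fk; case: no; exists (f k).
have := uniq_leq_size _ sub; rewrite map_inj_uniq // iota_uniq size_map size_iota ltnn.
by move/(_ isT).
Qed.

Definition near_one (K e c v : C) := `|v| = 1 /\ `|v - 1 + e * c| <= K * e ^+ 2.

(** The Cayley transform [(1 + b) / (1 - b)] of a purely imaginary [b] lies on the unit circle and
    is [1 + 2 b] to first order. A summand of order [e^2] in [b], scaled by [ta k], produces
    infinitely many points within the allowed error. *)
Lemma infinite_near_one (K e c : C) : c + c^* = 0 -> 0 < e -> e <= 1 ->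
  1 + (`|c| + 1) ^+ 2 <= K -> infinite (near_one K e c).
Proof.
move=> cc e0 e1 hK.
have er : e^* = e by apply/CrealP/gtr0_real.
pose ta k : C := k.+1%:R^-1.
pose b k := - (e * c) / 2 + 'i * (e ^+ 2 * ta k) / 2.
have tak k : (ta k)^* = ta k by rewrite /ta fmorphV /= rmorph_nat.
have ccN : c^* = - c by apply/eqP; rewrite -addr_eq0 addrC cc.
have bN k : (b k)^* = - b k.
  rewrite /b; move: (ta k) (tak k) => t tk.
  rewrite !(rmorphD, rmorphN, rmorphM, fmorphV, rmorphXn) /= conjCi !er tk ccN !rmorph1.
  by field.
have b1 k : 1 <= `|1 - b k|.
  rewrite -(@ler_pXn2r _ 2) ?nnegrE // expr1n normCK rmorphB rmorph1 /= bN opprK.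
  have -> : (1 - b k) * (1 + b k) = 1 + b k * (b k)^* by rewrite bN; ring.
  by rewrite lerDl mul_conjC_ge0.
have b1' k : 1 - b k != 0 by rewrite -normr_gt0; apply: lt_le_trans (b1 k).
have b1p k : 1 + b k != 0.
  by rewrite -(conjC_eq0) rmorphD rmorph1 /= bN.
pose v k := (1 + b k) / (1 - b k).
apply: (@infinite_injective _ _ v) => [k l|k].
  move=> vkl; have bkl : b k = b l.
    have : 2 * (b k - b l) = 0.
      transitivity ((1 - b k) * (1 - b l) * (v k - v l)); first by rewrite /v; field; rewrite !b1'.
      by rewrite vkl subrr mulr0.
    by move/eqP; rewrite mulf_eq0 pnatr_eq0 /= subr_eq0 => /eqP.
  have : 'i * e ^+ 2 * (ta k - ta l) = 0.
    by transitivity (2 * (b k - b l)); [rewrite /b; field|rewrite bkl subrr mulr0].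
  move/eqP; rewrite !mulf_eq0 (gt_eqF e0) (negPf (neq0Ci C)) /= subr_eq0 => /eqP.
  by move/invr_inj/eqP; rewrite eqr_nat eqSS => /eqP.
split.
  apply/eqP; rewrite -sqrp_eq1 // normCK /v rmorphM fmorphV rmorphD rmorphB rmorph1 /= bN opprK.
  by apply/eqP; field; rewrite b1' b1p.
have -> : v k - 1 + e * c = 2 * b k ^+ 2 / (1 - b k) + 'i * (e ^+ 2 * ta k).
  have -> : e * c = 'i * (e ^+ 2 * ta k) - 2 * b k by rewrite /b; field.
  by rewrite /v; field.
have ta0 : 0 < ta k by rewrite invr_gt0 ltr0n.
have ta1 : ta k <= 1 by rewrite invf_le1 ?ltr0n // ler1n.
have e2 : 0 < e ^+ 2 by rewrite exprn_gt0.
apply: le_trans (ler_normD _ _) _.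
have h2 : `|'i * (e ^+ 2 * ta k)| <= e ^+ 2.
  rewrite normrM normCi mul1r gtr0_norm ?mulr_gt0 //.
  by rewrite ler_piMr // ltW.
have bk : `|b k| <= e * (`|c| + 1) / 2.
  apply: le_trans (ler_normD _ _) _.
  have -> : `|- (e * c) / 2| = e * `|c| / 2.
    by rewrite normrM normrN normrM normfV normr_nat (gtr0_norm e0).
  have -> : `|'i * (e ^+ 2 * ta k) / 2| = e ^+ 2 * ta k / 2.
    by rewrite normrM normrM normCi mul1r normfV normr_nat gtr0_norm // mulr_gt0.
  rewrite -mulrDl mulrDr ler_pM2r ?invr_gt0 ?ltr0n // lerD2l mulr1.
  apply: le_trans (_ : e ^+ 2 <= _); first by rewrite ler_piMr // ltW.
  by rewrite expr2 ler_piMr // ltW.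
have h1 : `|2 * b k ^+ 2 / (1 - b k)| <= (`|c| + 1) ^+ 2 * e ^+ 2.
  rewrite normrM normrM normfV normrX normr_nat.
  apply: le_trans (_ : 2 * `|b k| ^+ 2 <= _).
    by rewrite ler_pdivrMr ?(lt_le_trans _ (b1 k)) // ler_peMr // mulr_ge0 ?exprn_ge0.
  apply: le_trans (_ : 2 * (e * (`|c| + 1) / 2) ^+ 2 <= _).
    rewrite ler_pM2l ?ltr0n // ler_pXn2r ?nnegrE //.
    by rewrite divr_ge0 ?mulr_ge0 ?addr_ge0 ?ler0n // ltW.
  have -> : 2 * (e * (`|c| + 1) / 2) ^+ 2 = (`|c| + 1) ^+ 2 * e ^+ 2 / 2 by field.
  by rewrite ler_pdivrMr ?ltr0n // ler_peMr ?ler1n // mulr_ge0 ?exprn_ge0 ?addr_ge0 // ltW.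
apply: le_trans (lerD h1 h2) _; rewrite -[X in _ + X]mul1r -mulrDl addrC.
by rewrite ler_pM2r.
Qed.

(** Once the real parts of [x] and [y] are known, [a x + b y] and its conjugate are two equations
    for the imaginary parts; here [x] is eliminated. *)
Lemma conj_elimination (a b x y : C) :
  a^* * (a * x + b * y) - a * (a^* * (x + x^*) + b^* * (y + y^*) - (a * x + b * y)^*) =
  (a^* * b - a * b^*) * y.
Proof. by rewrite rmorphD !rmorphM /=; ring. Qed.

(** The value at each node is [1 - e g + O(e^2)] on the unit circle; the first [m] values are free
    within this bound, and the last two restore the linear condition on the degree. By linearity of
    interpolation the same expansion holds at the other roots, where [|f|^2 = 1 - 2 e Re g + O(e^2)]
    is below 1. *)
Lemma perturbation n w m (g : {poly C}) : n.-primitive_root w -> (0 < m)%N -> (m.+1 < n)%N ->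
  (size g <= m.+1)%N -> (forall j, (j <= m.+1)%N -> 'Re g.[w ^+ j] = 0) ->
  (forall j, (m.+1 < j < n)%N -> 0 < 'Re g.[w ^+ j]) ->
  let b := bary (GRing.exp w) m.+1 in
  exists S : nat -> C -> Prop, [/\ forall j, (j < m)%N -> infinite (S j), forall j v, S j v -> `|v| = 1 &
    forall u, (forall j, (j < m)%N -> S j (u j)) ->
    exists u' : nat -> C, [/\ forall j, (j < m)%N -> u' j = u j, forall j, (j <= m.+1)%N -> `|u' j| = 1,
      \sum_(j < m.+2) b j * u' j = 0 &
      forall j, (m.+1 < j < n)%N -> `|(interp (GRing.exp w) m.+1 u').[w ^+ j]| < 1]].
Proof.
move=> pw m0 mn sg g0 gpos b.
have inj : forall i j, (i <= m.+1)%N -> (j <= m.+1)%N -> w ^+ i = w ^+ j -> i = j.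
  by move=> i j hi hj; apply: (prim_inj pw); lia.
pose c j := g.[w ^+ j].
have cc j : (j <= m.+1)%N -> c j + (c j)^* = 0.
  move=> /g0 h; have : (c j + (c j)^*) / 2 = 0 by rewrite -ReE.
  by move/eqP; rewrite mulf_eq0 invr_eq0 pnatr_eq0 orbF => /eqP.
pose K := 1 + \sum_(j < m) (`|c j| + 1) ^+ 2.
have hK j : (j < m)%N -> 1 + (`|c j| + 1) ^+ 2 <= K.
  move=> jm; rewrite lerD2l (bigD1 (Ordinal jm)) //= lerDl.
  by apply: sumr_ge0 => i _; rewrite exprn_ge0 // addr_ge0.
(* An index is a parameter together with an admissible choice of the first [m] values. The estimates
   are thus uniform in that choice, and one [ep] serves all of them at the end. *)
pose I := {p : C * (nat -> C) | [/\ 0 < p.1, p.1 <= 1 & forall j, (j < m)%N -> near_one K p.1 (c j) (p.2 j)]}.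
pose eps (i : I) := (sval i).1; pose u (j : nat) (i : I) := (sval i).2 j.
have eps0 i : 0 < eps i by have [] := svalP i.
have eps1 i : eps i <= 1 by have [] := svalP i.
have epsr i : (eps i)^* = eps i by apply/CrealP/gtr0_real.
have un i j : (j < m)%N -> near_one K (eps i) (c j) (u j i).
  by move=> jm; have [_ _ h] := svalP i; apply: h.
(* Because the weights sum to zero, the last two nodes have to contribute [b m + b m.+1] in the
   limit, as [triangle] requires. *)
have sum1 : \sum_(j < m.+2) b j = 0.
  have := bary_sum inj (p := 1) _; rewrite size_poly1 => /(_ isT) h.
  by rewrite -[RHS]h; apply: eq_bigr => j _; rewrite hornerC mulr1.
have sumb : \sum_(j < m) b j = - (b m + b m.+1).
  by apply/eqP; rewrite -addr_eq0 addrA; move: sum1; rewrite !big_ord_recr /= => ->.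
have sumc : \sum_(j < m.+2) b j * c j = 0 by apply: (bary_sum inj).
have ob : bigO eps 1 eps by apply: bigO_eps.
have weak21 f : bigO eps 2 f -> bigO eps 1 f by apply: bigO_weak.
have O2 j : (j < m)%N -> bigO eps 2 (fun i => u j i - 1 + eps i * c j).
  move=> jm; exists K; first by rewrite addr_ge0 // sumr_ge0 // => i _; rewrite exprn_ge0 // addr_ge0.
  by exists 1 => // i _; case: (un i j jm).
have Oec j : bigO eps 1 (fun i => eps i * c j).
  by apply: (bigOM (k := 1) (l := 0)) => //; apply: bigO_cst.
have O1 j : (j < m)%N -> bigO eps 1 (fun i => u j i - 1).
  move=> jm; apply: (@bigO_eq _ _ _ _ (fun i => (u j i - 1 + eps i * c j) - eps i * c j)).
    by move=> i; rewrite addrK.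
  by apply: bigOB => //; apply: weak21; apply: O2.
pose rhs i := - \sum_(j < m) b j * u j i.
have Orhs : bigO eps 1 (fun i => rhs i - (b m + b m.+1)).
  apply: (@bigO_eq _ _ _ _ (fun i => - \sum_(j < m) b j * (u j i - 1))).
    move=> i; have -> : \sum_(j < m) b j * (u j i - 1) = \sum_(j < m) b j * u j i - \sum_(j < m) b j.
      by rewrite -sumrB; apply: eq_bigr => j _; rewrite mulrBr mulr1.
    by rewrite sumb /rhs; ring.
  by apply: bigON; apply: (@bigO_sum _ _ _ _ _ (fun j i => b j * (u j i - 1))) => j jm; apply: bigOZ; apply: O1.
have par := bary_nonparallel pw mn m0; rewrite -/b in par.
have [U [V [UV OU OV]]] := triangle eps0 eps1 par Orhs.
pose full i j := if (j < m)%N then u j i else if j == m then U i else V i.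
have fu i j : (j < m)%N -> full i j = u j i by rewrite /full => ->.
have fm i : full i m = U i by rewrite /full ltnn eqxx.
have fM i : full i m.+1 = V i by rewrite /full ltnNge leqnSn /= eqn_leq ltnn.
have fsum : eventually eps (fun i => \sum_(j < m.+2) b j * full i j = 0).
  apply: eventually_sub UV => i [_ _ h]; rewrite !big_ord_recr /= fm fM -addrA h /rhs.
  rewrite (eq_bigr (fun j : 'I_m => b j * u j i)) ?subrr // => j _.
  by rewrite fu.
have fnorm : eventually eps (fun i => forall j, (j <= m.+1)%N -> `|full i j| = 1).
  apply: eventually_sub UV => i [U1 V1 _] j jm.
  have [lt|ge] := ltnP j m; first by rewrite fu //; case: (un i j lt).
  by rewrite /full ltnNge ge /=; case: ifP.
(* First-order matching at the two solved nodes: the real parts are quadratically small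
   because the values are unit numbers, and the imaginary parts are determined by the
   linear relation since [b m] and [b m.+1] are not parallel. *)
pose eU i := U i - 1 + eps i * c m; pose eV i := V i - 1 + eps i * c m.+1.
have Oev (W : I -> C) j : (j <= m.+1)%N -> eventually eps (fun i => `|W i| = 1) -> bigO eps 1 (fun i => W i - 1) ->
    bigO eps 2 (fun i => (W i - 1 + eps i * c j) + (W i - 1 + eps i * c j)^*).
  move=> jm W1 OW; apply: (@bigO_ev _ _ _ _ (fun i => - ((W i - 1) * (W i - 1)^*))).
    apply: eventually_sub W1 => i /norm1_conj e.
    rewrite !rmorphD rmorphN rmorph1 rmorphM /= epsr.
    transitivity (1 - W i * (W i)^* + (W i - 1) + ((W i)^* - 1) + eps i * (c j + (c j)^*)); last by rewrite e; ring.
    by rewrite cc // e; ring: e.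
  by apply: bigON; apply: (bigOM (k := 1) (l := 1)) => //; apply: bigO_conj.
have OeU : bigO eps 2 (fun i => eU i + (eU i)^*).
  by apply: Oev => //; apply: eventually_sub UV => i [].
have OeV : bigO eps 2 (fun i => eV i + (eV i)^*).
  by apply: Oev => //; apply: eventually_sub UV => i [].
pose E i := b m * eU i + b m.+1 * eV i.
have OE : bigO eps 2 E.
  apply: (@bigO_ev _ _ _ _ (fun i => - \sum_(j < m) b j * (u j i - 1 + eps i * c j))).
    apply: eventually_sub UV => i [_ _ h].
    have -> : \sum_(j < m) b j * (u j i - 1 + eps i * c j) =
        \sum_(j < m) b j * u j i - \sum_(j < m) b j + eps i * \sum_(j < m) b j * c j.
      by rewrite mulr_sumr -sumrB -big_split; apply: eq_bigr => j _ /=; ring.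
    move: sumc; rewrite !big_ord_recr /= => s2.
    have e2 : \sum_(j < m) b j * c j = - (b m * c m + b m.+1 * c m.+1).
      by apply/eqP; rewrite -addr_eq0 addrA s2.
    have e3 : \sum_(j < m) b j * u j i = - (b m * U i + b m.+1 * V i) by rewrite h /rhs opprK.
    by rewrite sumb e2 e3 /E /eU /eV; ring.
  by apply: bigON; apply: (@bigO_sum _ _ _ _ _ (fun j i => b j * (u j i - 1 + eps i * c j))) => j jm; apply: bigOZ; apply: O2.
have O2V : bigO eps 2 eV.
  set Dl := _ - _ in par.
  apply: (@bigO_eq _ _ _ _ (fun i => Dl^-1 * ((b m)^* * E i - b m *
     ((b m)^* * (eU i + (eU i)^*) + (b m.+1)^* * (eV i + (eV i)^*) - (E i)^*)))).
    by move=> i; rewrite /E conj_elimination mulKf.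
  apply: bigOZ; apply: bigOB; first exact: bigOZ.
  apply: bigOZ; apply: bigOB; last exact: bigO_conj.
  by apply: bigOD; apply: bigOZ.
have bm0 : b m != 0 by apply: bary_neq0 => //; lia.
have O2U : bigO eps 2 eU.
  apply: (@bigO_eq _ _ _ _ (fun i => (b m)^-1 * (E i - b m.+1 * eV i))).
    by move=> i; rewrite /E; field.
  by apply: bigOZ; apply: bigOB => //; apply: bigOZ.
have O2full j : (j < m.+2)%N -> bigO eps 2 (fun i => full i j - 1 + eps i * c j).
  move=> jm; have [lt|ge] := ltnP j m.
    by apply: (bigO_eq _ (O2 j lt)) => i; rewrite fu.
  have [->|ne] := eqVneq j m; first by apply: (bigO_eq _ O2U) => i; rewrite fm.
  have -> : j = m.+1 by move: jm ge ne; lia.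
  by apply: (bigO_eq _ O2V) => i; rewrite fM.
have small j : (j < n)%N -> eventually eps (fun i => (m.+1 < j)%N -> `|(interp (GRing.exp w) m.+1 (full i)).[w ^+ j]| < 1).
  move=> jn; have [mj|] := ltnP m.+1 j; last by exists 1.
  set z := w ^+ j; have zpos : 0 < 'Re g.[z] by apply: gpos; rewrite mj.
  pose f i := (interp (GRing.exp w) m.+1 (full i)).[z].
  (* The polynomials [1] and [g] coincide with their interpolants, so the error at [z] is a fixed
     linear combination of the errors at the nodes. *)
  have Of : bigO eps 2 (fun i => f i - 1 + eps i * g.[z]).
    apply: (@bigO_eq _ _ _ _ (fun i => \sum_(k < m.+2) (lagr (GRing.exp w) m.+1 k).[z] * (full i k - 1 + eps i * c k))).
      move=> i; have e1 := interp_unique inj (p := 1) _; rewrite size_poly1 in e1.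
      have e2 := interp_unique inj (p := g) (leqW sg).
      have -> : f i - 1 + eps i * g.[z] = f i - (1 : {poly C}).[z] + eps i * g.[z] by rewrite hornerC.
      rewrite {1}(e1 isT) {1}e2 /f /interp !horner_sum mulr_sumr -sumrB -big_split /=.
      by apply: eq_bigr => k _; rewrite !hornerZ hornerC /c; ring.
    apply: (@bigO_sum _ _ _ _ _ (fun k i => (lagr (GRing.exp w) m.+1 k).[z] * (full i k - 1 + eps i * c k))) => k km.
    by apply: bigOZ; apply: O2full.
  pose r i := f i - 1 + eps i * g.[z].
  have Or1 : bigO eps 1 r by apply: weak21.
  pose h := g.[z].
  have Oeh : bigO eps 1 (fun i => - (eps i * h) + r i).
    apply: bigOD => //; apply: bigON.
    by apply: (bigOM (k := 1) (l := 0)) => //; apply: bigO_cst.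
  have Onorm : bigO eps 2 (fun i => f i * (f i)^* - 1 + eps i * (h + h^*)).
    apply: (@bigO_eq _ _ _ _ (fun i => (r i + (r i)^*) + (- (eps i * h) + r i) * (- (eps i * h) + r i)^*)).
      move=> i; have ef : f i = 1 - eps i * h + r i by rewrite /r /h; ring.
      rewrite ef !(rmorphD, rmorphN, rmorphM, rmorph1) /= epsr; ring.
    apply: bigOD; first by apply: bigOD => //; apply: bigO_conj.
    by apply: (bigOM (k := 1) (l := 1)) => //; apply: bigO_conj.
  have hh : h + h^* = 2 * 'Re h by rewrite ReE mulrC divfK // pnatr_eq0.
  have h0 : 0 < h + h^* by rewrite hh mulr_gt0 // ltr0n.
  apply: eventually_sub (bigO_dominated eps0 h0 Onorm) => i; rewrite expr1 => lt _.
  rewrite -/(f i) -(@ltr_pXn2r _ 2) ?nnegrE // expr1n normCK.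
  have re : f i * (f i)^* - 1 + eps i * (h + h^*) \is Num.real.
    have r1 : f i * (f i)^* \is Num.real by apply: ger0_real; apply: mul_conjC_ge0.
    exact: realD (realB r1 (real1 C)) (realM (gtr0_real (eps0 i)) (gtr0_real h0)).
  have := le_lt_trans (real_ler_norm re) lt; rewrite [(h + h^*) * _]mulrC -[X in _ < X -> _]add0r ltrD2r subr_lt0.
  by [].
have big_ev := eventually_and (eventually_and fsum fnorm) (eventually_all small).
case: big_ev => e e0 He.
have [ep [ep0 ep1 epe]] : exists ep : C, [/\ 0 < ep, ep <= 1 & ep < e].
  have e2 : 0 < e / 2 by rewrite divr_gt0 ?ltr0n.
  have ee : e / 2 < e by rewrite ltr_pdivrMr ?ltr0n // ltr_pMr // ltr1n.
  have [le|lt] := real_leP (real1 C) (gtr0_real e2); last by exists (e / 2); rewrite ltW.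
  by exists 1; split=> //; apply: le_lt_trans ee.
exists (fun j => near_one K ep (c j)); split.
- by move=> j jm; apply: infinite_near_one => //; [apply: cc; lia|apply: hK].
- by move=> j v [].
move=> uu hu; pose i : I := exist _ (ep, uu) (And3 ep0 ep1 hu).
have [[h1 h2] h3] := He i epe.
exists (full i); split=> //; first by move=> j jm; rewrite fu.
by move=> j /andP[mj jn]; apply: h3.
Qed.

End Perturbation.

(** * The polynomial of the last party *)

Section Nondegeneracy.
Local Open Scope ring_scope.
Variable C : numClosedFieldType.

(** On the unit circle the equation is quadratic in [v], with leading coefficient the conjugate of
    [A] times [B]. *)
Lemma circle_finite (A B T : C) : A != 0 -> B != 0 ->
  exists L : seq C, forall v, `|v| = 1 -> (A + B * v) * (A + B * v)^* = T -> v \in L.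
Proof.
move=> A0 B0; pose p := Poly [:: A * B^*; A * A^* + B * B^* - T; A^* * B].
have p0 : p != 0.
  apply: contraTneq (mulf_neq0 (_ : A^* != 0) B0) => [p0|]; last by rewrite conjC_eq0.
  by have := congr1 (fun q : {poly C} => q`_2) p0; rewrite coef_Poly coef0 /= => ->; rewrite eqxx.
have [L HL] := roots_finite p0; exists L => v v1 e; apply: HL.
rewrite /root horner_Poly /= mul0r add0r.
have vv := norm1_conj v1; rewrite rmorphD rmorphM /= in e.
apply/eqP; transitivity (v * ((A + B * v) * (A^* + B^* * v^*) - T) +
   (1 - v * v^*) * (A * B^* + B * B^* * v)); first by ring.
by rewrite e vv !subrr mulr0 mul0r addr0.
Qed.

Variables (n : nat) (w : C).
Hypothesis pw : n.-primitive_root w.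
Let X (k : 'I_n) := w ^+ k.

Lemma powers_inj : injective X.
Proof. by move=> i j e; apply/val_inj/(prim_inj pw (ltn_ord i) (ltn_ord j) e). Qed.

Lemma powers_neq0 k : X k != 0.
Proof. exact: (prim_neq0 pw). Qed.

Lemma powers_unity k : X k ^+ n = 1.
Proof. by rewrite /X exprAC (prim_expr_order pw) expr1n. Qed.

Lemma expsum_split (k : 'I_n) x i :
  expsum X x i = x k * X k ^+ i + expsum X (fun j => if j == k then 0 else x j) i.
Proof.
rewrite /expsum (bigD1 k) //= [in RHS](bigD1 k) //= eqxx mul0r add0r; congr (_ + _).
by apply: eq_bigr => j /negPf ->.
Qed.

Lemma weight_split (k : 'I_n) (x : 'I_n -> C) : x k != 0 ->
  (weight (fun j => if j == k then 0%R else x j)).+1 = weight x.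
Proof.
move=> xk; rewrite /weight [RHS](cardsD1 k) inE xk add1n; congr _.+1.
by apply: eq_card => j; rewrite !inE; case: (eqVneq j k) => /= _; rewrite ?eqxx.
Qed.

Lemma expsum_weight1 (k0 : 'I_n) x : (weight x <= 1)%N ->
  exists k, exists c, forall i, expsum X x i = c * X k ^+ i.
Proof.
move=> wx; have [/existsP[k xk]|] := boolP [exists k, x k != 0].
  exists k, (x k) => i; rewrite (expsum_split k) expsum0 ?addr0 //.
  by apply: weight0; apply/eqP; rewrite -leqn0 -ltnS weight_split.
rewrite negb_exists => /forallP h; exists k0, 0 => i; rewrite mul0r expsum0 // => k.
by have := h k; rewrite negbK => /eqP.
Qed.

Lemma expsum_weight2 (k0 : 'I_n) x : (weight x <= 2)%N ->
  exists k k', exists c c', forall i, expsum X x i = c * X k ^+ i + c' * X k' ^+ i.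
Proof.
move=> wx; have [/existsP[k xk]|] := boolP [exists k, x k != 0].
  have [|k' [c' e]] := @expsum_weight1 k (fun j => if j == k then 0 else x j).
    by rewrite -ltnS weight_split.
  by exists k, k', (x k), c' => i; rewrite (expsum_split k) e.
rewrite negb_exists => /forallP h; exists k0, k0, 0, 0 => i.
rewrite !mul0r addr0 expsum0 // => k.
by have := h k; rewrite negbK => /eqP.
Qed.

(** If [y] is a single nonzero term, division by it gives [v i = c A^i + c' B^i] with roots of unity
    [A] and [B]. Equal moduli for [i = 0, 1, 2] force [A^2 = B^2] when [c] and [c'] are nonzero, so
    [v 2] is [A^2] times [v 0]; if [c] or [c'] is zero, [v 1] is a root of unity times [v 0]. Both
    are excluded. *)
Lemma three_rows (v : nat -> C) x y : (forall i, (i <= 2)%N -> `|v i| = 1) ->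
  (forall xi, xi ^+ n = 1 -> v 1%N != xi * v 0%N /\ v 2%N != xi * v 0%N) ->
  (weight x <= 2)%N -> (weight y <= 1)%N ->
  (forall i, (i <= 2)%N -> expsum X x i = v i * expsum X y i) ->
  (forall k, x k = 0) /\ (forall k, y k = 0).
Proof.
move=> v1 vne wx wy h.
have k0 : 'I_n by case: (n) (prim_order_gt0 pw) => // n' _; exact: ord0.
suff y0 : forall k, y k = 0.
  split=> //; apply: (vandermonde powers_inj powers_neq0 (i := 0) (l := 2)) => // i /= i2.
  by rewrite h ?(ltnW i2) // expsum0 // mulr0.
have [k [d ey]] := expsum_weight1 k0 wy.
have [a [b [c [c' ex]]]] := expsum_weight2 k0 wx.
have [d0|d0] := eqVneq d 0.
  apply: (vandermonde powers_inj powers_neq0 (i := 0) (l := 1)) => // i _.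
  by rewrite ey d0 mul0r.
exfalso; pose A := X a / X k; pose B := X b / X k.
have hv i : (i <= 2)%N -> v i = c / d * A ^+ i + c' / d * B ^+ i.
  move=> i2; have Xk := powers_neq0 k.
  have e := h i i2; rewrite ex ey in e.
  rewrite /A /B !expr_div_n.
  have -> : v i = v i * (d * X k ^+ i) / (d * X k ^+ i) by rewrite (mulfK (mulf_neq0 d0 (expf_neq0 i Xk))).
  rewrite -e; have := expf_neq0 i Xk; move: (X k ^+ i) (X a ^+ i) (X b ^+ i) => xk xa xb xk0.
  by field; rewrite d0 xk0.
have An : A ^+ n = 1 by rewrite expr_div_n !powers_unity divr1.
have Bn : B ^+ n = 1 by rewrite expr_div_n !powers_unity divr1.
have n0 := prim_order_gt0 pw.
have nA := norm_unity n0 An; have nB := norm_unity n0 Bn.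
have A0 : A != 0 by rewrite -normr_eq0 nA oner_eq0.
have B0 : B != 0 by rewrite -normr_eq0 nB oner_eq0.
move: (c / d) (c' / d) hv => {c c' ex} c c' hv.
have v0 : v 0%N = c + c' by rewrite hv // !expr0 !mulr1.
have [|_ h2A] := vne (A ^+ 2); first by rewrite exprAC An expr1n.
have [h1 _] := vne A An; have [h1' _] := vne B Bn.
have sqAB : A ^+ 2 != B ^+ 2.
  by apply: contraNneq h2A => e; rewrite hv // -e v0; apply/eqP; ring.
have AB : A != B by apply: contraNneq sqAB => ->.
have c0 : c != 0 by apply: contraNneq h1' => e; rewrite hv // v0 e !expr1; apply/eqP; ring.
have c'0 : c' != 0 by apply: contraNneq h1 => e; rewrite hv // v0 e !expr1; apply/eqP; ring.
have N i : (i <= 2)%N -> (c * A ^+ i + c' * B ^+ i) * (c^* / A ^+ i + c'^* / B ^+ i) = 1.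
  move=> i2; rewrite -(norm1_conj (v1 i i2)) hv // rmorphD !rmorphM !rmorphXn /=.
  by rewrite (conj_norm1 nA) (conj_norm1 nB) !exprVn.
have N0 := N 0%N isT; have N1 := N 1%N isT; have N2 := N 2%N isT.
rewrite !expr0 in N0; rewrite !expr1 in N1.
set P := c * c'^*; set P' := c^* * c'.
have P0 : P != 0 by rewrite mulf_neq0 // conjC_eq0.
have F1 : P * A = P' * B.
  apply: (mulIf (_ : A - B != 0)); first by rewrite subr_eq0.
  apply/eqP; rewrite -subr_eq0; apply/eqP.
  transitivity (A * B * ((c * A + c' * B) * (c^* / A + c'^* / B) - (c * 1 + c' * 1) * (c^* / 1 + c'^* / 1))).
    by rewrite /P /P'; field; rewrite A0 B0.
  by rewrite N0 N1 subrr mulr0.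
have F2 : P * A ^+ 3 = P' * B ^+ 3.
  apply: (mulIf (_ : A - B != 0)); first by rewrite subr_eq0.
  apply/eqP; rewrite -subr_eq0; apply/eqP.
  transitivity (A ^+ 2 * B ^+ 2 * ((c * A ^+ 2 + c' * B ^+ 2) * (c^* / A ^+ 2 + c'^* / B ^+ 2) - (c * A + c' * B) * (c^* / A + c'^* / B))).
    by rewrite /P /P'; field; rewrite A0 B0.
  by rewrite N2 N1 subrr mulr0.
case/negP: sqAB; apply/eqP/(mulfI (mulf_neq0 P0 A0)).
transitivity (P * A ^+ 3); first by ring.
by rewrite F2 F1; ring.
Qed.

Definition nondegenerate s (f : {poly C}) := forall x y,
  (weight x + weight y <= s)%N ->
  (forall i, (i <= s)%N -> expsum X x i = f.[w ^+ i] * expsum X y i) ->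
  (forall k, x k = 0) /\ (forall k, y k = 0).

(** If one of the sums is empty, the other is killed by [vandermonde]. Otherwise one of them has a
    single term, and [three_rows] applies either to [f] or, with the roles of [x] and [y] exchanged,
    to the inverse values. *)
Lemma nondegenerate3 (f : {poly C}) : (3 < n)%N -> (forall i, (i <= 3)%N -> `|f.[w ^+ i]| = 1) ->
  (forall xi, xi ^+ n = 1 -> f.[w ^+ 1] != xi * f.[w ^+ 0] /\ f.[w ^+ 2] != xi * f.[w ^+ 0]) ->
  nondegenerate 3 f.
Proof.
move=> n3 f1 fne x y wxy h.
have f0 i : (i <= 3)%N -> f.[w ^+ i] != 0 by move=> /f1 e; rewrite -normr_eq0 e oner_eq0.
have [wy|wy] := leqP (weight y) 0.
  have y0 : forall k, y k = 0 by apply: weight0; lia.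
  split=> //; apply: (vandermonde powers_inj powers_neq0 (i := 0) (l := 3)); first by lia.
  by move=> i /= i3; rewrite h ?(ltnW i3) // expsum0 ?mulr0.
have [wx|wx] := leqP (weight x) 0.
  have x0 : forall k, x k = 0 by apply: weight0; lia.
  split=> //; apply: (vandermonde powers_inj powers_neq0 (i := 0) (l := 3)); first by move: wxy; lia.
  by move=> i /= i3; apply: (mulfI (f0 i (ltnW i3))); rewrite -h ?(ltnW i3) // expsum0 ?mulr0.
have [wx2|wx2] := leqP (weight y) 1.
  apply: (three_rows (v := fun i => f.[w ^+ i])) => //; first by move=> i i2; apply: f1; lia.
    by lia.
  by move=> i i2; apply: h; lia.
suff: (forall k, y k = 0) /\ (forall k, x k = 0) by case.
apply: (three_rows (v := fun i => f.[w ^+ i]^-1)); try lia.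
- by move=> i i2; rewrite normfV f1 ?invr1 //; lia.
- move=> xi xn; have [|g1 g2] := fne xi^-1; first by rewrite exprVn xn invr1.
  split.
    apply: contraNneq g1 => e; rewrite -[f.[w ^+ 1]]invrK e invfM invrK //.
  by apply: contraNneq g2 => e; rewrite -[f.[w ^+ 2]]invrK e invfM invrK.
- by move=> i i2; rewrite h ?mulKf ?f0 //; lia.
Qed.

End Nondegeneracy.

Section PolynomialExistence.
Local Open Scope ring_scope.
Variable C : numClosedFieldType.

(** For [n = 4] the four barycentric weights have equal modulus and the conclusion of [bary_norms]
    fails, so this case is treated by an explicit polynomial. No root of unity remains outside the
    nodes. *)
Lemma exists_polynomial4 w : 4.-primitive_root w -> exists f : {poly C},
  [/\ (size f <= 3)%N, forall j, (j <= 3)%N -> `|f.[w ^+ j]| = 1 &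
      nondegenerate 4 w 3 f].
Proof.
move=> pw.
have w2 : w ^+ 2 = -1.
  have := prim_expr_order pw; rewrite -[4%N]/(2 * 2)%N exprM => /eqP.
  rewrite sqrf_eq1 => /orP[/eqP e|/eqP //].
  by have := prim_order_dvd pw 2; rewrite e eqxx.
(* A unit number that is not a fourth root of unity. *)
pose v : C := (3 + 4 * 'i) / 5.
have i2 := sqrCi C.
have cv : v^* = (3 - 4 * 'i) / 5.
  by rewrite /v rmorphM fmorphV rmorphD rmorphM /= conjCi !rmorph_nat mulrN.
have v1 : `|v| = 1.
  by apply/eqP; rewrite -sqrp_eq1 // normCK cv /v; apply/eqP; field: i2.
have v4 : v ^+ 4 != 1.
  apply/eqP => h; have e : (v + v^*) * (v^* - v) * (v ^+ 2) = 0.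
    have vc := norm1_conj v1.
    transitivity (v * v^* * (v * v^*) - v ^+ 4); first by ring.
    by rewrite vc h; ring.
  have v0 : v != 0 by rewrite -normr_eq0 v1 oner_eq0.
  have hp : v + v^* != 0.
    have -> : v + v^* = 6 / 5 by rewrite cv /v; field.
    by rewrite mulf_neq0 ?invr_eq0 ?pnatr_eq0.
  have hm : v^* - v != 0.
    have -> : v^* - v = - (8 / 5) * 'i by rewrite cv /v; field.
    by rewrite mulf_neq0 ?neq0Ci // oppr_eq0 mulf_neq0 ?invr_eq0 ?pnatr_eq0.
  by case/eqP: (mulf_neq0 (mulf_neq0 hp hm) (expf_neq0 2 v0)).
(* The quadratic polynomial with the values [1], [- w v], [v], [- w] at the four roots of unity. *)
clearbody v; pose f := Poly [:: (1 + v) * (1 - w) / 4; (1 - v) / 2; (1 + v) * (1 + w) / 4].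
have fE z : f.[z] = (1 + v) * (1 - w) / 4 + (1 - v) / 2 * z + (1 + v) * (1 + w) / 4 * z ^+ 2.
  by rewrite horner_Poly /=; ring.
have f0 : f.[w ^+ 0] = 1 by rewrite fE; field.
have f1 : f.[w ^+ 1] = - (w * v) by rewrite fE; field: w2.
have f2 : f.[w ^+ 2] = v by rewrite fE w2; field.
have f3 : f.[w ^+ 3] = - w.
  by rewrite fE exprS w2; field: w2.
have w1 : `|w| = 1 by rewrite -[w]expr1 (prim_norm pw).
exists f; split; first exact: size_Poly.
  by case=> [|[|[|[|//]]]] _; rewrite ?f0 ?f1 ?f2 ?f3 ?normrN ?normrM ?w1 ?v1 ?normr1 ?mulr1 //.
apply: (nondegenerate3 pw) => //.
  by case=> [|[|[|[|//]]]] _; rewrite ?f0 ?f1 ?f2 ?f3 ?normrN ?normrM ?w1 ?v1 ?normr1 ?mulr1 //.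
move=> xi x4; rewrite f0 f1 f2 mulr1; split; apply: contraNneq v4 => e; last by rewrite e x4.
have : (- (w * v)) ^+ 4 = v ^+ 4.
  by transitivity ((w ^+ 2) ^+ 2 * v ^+ 4); [ring|rewrite w2; ring].
by rewrite e x4 => <-.
Qed.

Section Generic.
Variables (n : nat) (w : C).
Hypothesis pw : n.-primitive_root w.
Hypothesis extw : forall v, v ^+ n = 1 -> v != 1 -> 'Re v <= 'Re w.

(** The two weights have different moduli, since [|w^3 - 1| = |w - 1|] would give
    [(w^2 - 1) (w^4 - 1) = 0]. For [s = 3] this keeps the coefficient of the first value nonzero
    when the third is a root of unity times the first. *)
Lemma bary_norms : (4 < n)%N -> forall xi, xi ^+ n = 1 ->
  bary (GRing.exp w) 3 0 + bary (GRing.exp w) 3 2 * xi != 0.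
Proof.
move=> n4 xi xn; apply/negP; rewrite addr_eq0 => /eqP e.
have x1 : `|xi| = 1 by apply: norm_unity xn; apply: (prim_order_gt0 pw).
have w0 : w != 0 by rewrite -[w]expr1 (prim_neq0 pw).
have w1 : `|w| = 1 by rewrite -[w]expr1 (prim_norm pw).
have ne k : (0 < k < n)%N -> w ^+ k - 1 != 0.
  by move=> kn; rewrite subr_eq0 -(expr0 w); apply/eqP => /(prim_inj pw); lia.
have := congr1 (fun z => `|z|^-1) e; rewrite normrN normrM x1 mulr1.
rewrite /bary ![\prod_(i < 4 | _) _]big_mkcond !big_ord_recr !big_ord0 /= !mul1r !mulr1.
rewrite !normfV !invrK expr0 expr1.
have -> : (1 - w) * (1 - w ^+ 2) * (1 - w ^+ 3) = - ((w - 1) * (w ^+ 2 - 1) * (w ^+ 3 - 1)) by ring.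
have -> : (w ^+ 2 - 1) * (w ^+ 2 - w) * (w ^+ 2 - w ^+ 3) = - ((w - 1) * (w ^+ 2 - 1) * (w ^+ 3 * (w - 1))) by ring.
have nz : `|(w - 1) * (w ^+ 2 - 1)| != 0.
  by rewrite normr_eq0 mulf_neq0 // -1?[X in X - 1]expr1 ne //; lia.
have n3 : `|w ^+ 3 * (w - 1)| = `|w - 1| by rewrite normrM (prim_norm pw) mul1r.
rewrite !normrN [LHS]normrM [RHS]normrM n3 => /(mulfI nz) e'.
have := congr1 (fun z => z ^+ 2) e'; rewrite !normCK !rmorphB rmorph1 rmorphXn /= conj_norm1 // => e2.
have : (w ^+ 2 - 1) * (w ^+ 4 - 1) = 0.
  transitivity (- w ^+ 3 * ((w ^+ 3 - 1) * (w^-1 ^+ 3 - 1) - (w - 1) * (w^-1 - 1))).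
    by field.
  by rewrite e2 subrr mulr0.
by move/eqP; rewrite mulf_eq0 (negPf (ne 2%N _)) ?(negPf (ne 4%N _)) //; lia.
Qed.

Lemma exists_polynomial_extremal s : (3 <= s)%N -> (s < n)%N -> (s == 3%N -> (4 < n)%N) -> exists f : {poly C},
  [/\ (size f <= s)%N, forall j, (j <= s)%N -> `|f.[w ^+ j]| = 1,
      forall j, (s < j < n)%N -> `|f.[w ^+ j]| < 1 & nondegenerate n w s f].
Proof.
case: s => // m m2 mn s3.
have [|g [sg g0 gpos]] := exists_positive pw extw (s := m.+1); first by lia.
have inj : forall i j, (i <= m.+1)%N -> (j <= m.+1)%N -> w ^+ i = w ^+ j -> i = j.
  by move=> i j hi hj; apply: (prim_inj pw); lia.
have [|||||S [Sinf S1 HS]] := perturbation (g := g) (m := m) pw; try by []; try lia.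
set b := bary _ _ in HS.
have b0 j : (j <= m.+1)%N -> b j != 0 by apply: bary_neq0.
suff [u [Su Hu]] : exists u, (forall j, (j < m)%N -> S j (u j)) /\
    forall u' : nat -> C, (forall j, (j < m)%N -> u' j = u j) -> (forall j, (j <= m.+1)%N -> `|u' j| = 1) ->
    \sum_(j < m.+2) b j * u' j = 0 -> nondegenerate n w m.+1 (interp (GRing.exp w) m.+1 u').
  have [u' [uu' u'1 usum ulast]] := HS u Su.
  exists (interp (GRing.exp w) m.+1 u'); split=> //.
  - exact: interp_size.
  - by move=> j jm; rewrite (interp_eval inj) ?u'1.
  - exact: Hu.
have [m3|m3] := eqVneq m 2%N.
  subst m; have n5 : (4 < n)%N by apply: s3.
  have [u0 Su0 _] := Sinf 0%N isT [::].
  have u01 := S1 _ _ Su0.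
  have u0n : u0 != 0 by rewrite -normr_eq0 u01 oner_eq0.
  (* The list excludes the second values that are [w^k u0], and those for which the third value
     could be [w^k u0]: then the linear relation prescribes the modulus of a combination of [u0] and
     the second value. *)
  have [L HL] : exists L : seq C, forall (k : 'I_n) v,
      (v = w ^+ k * u0 \/ (`|v| = 1 /\ ((b 0%N + b 2%N * w ^+ k) * u0 + b 1%N * v) *
        ((b 0%N + b 2%N * w ^+ k) * u0 + b 1%N * v)^* = b 3%N * (b 3%N)^*)) -> v \in L.
    apply: finite_union => k.
    have [||L HL] := @circle_finite _ ((b 0%N + b 2%N * w ^+ k) * u0) (b 1%N) (b 3%N * (b 3%N)^*).
    - by rewrite mulf_neq0 // bary_norms // (powers_unity pw).
    - exact: b0.
    exists (w ^+ k * u0 :: L) => v; rewrite in_cons => -[->|[v1 e]]; first by rewrite eqxx.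
    by rewrite HL ?orbT.
  have [u1 Su1 u1L] := Sinf 1%N isT L.
  exists (fun j => if j == 0%N then u0 else u1); split.
    by case=> [|[|//]].
  move=> u' uu' u'1 usum.
  have eu0 : u' 0%N = u0 by rewrite uu'.
  have eu1 : u' 1%N = u1 by rewrite uu'.
  apply: (nondegenerate3 pw) => [|i i3|xi xn]; first by lia.
    by rewrite (interp_eval inj) ?u'1.
  rewrite !(interp_eval inj) // eu0 eu1.
  have [k ->] := prim_rootP pw xn.
  split; apply: contraNneq u1L => e; apply: (HL k); first by left.
  right; split; first exact: S1 Su1.
  move: usum; rewrite !big_ord_recr big_ord0 /= add0r eu0 eu1 e => us.
  have -> : (b 0%N + b 2%N * w ^+ k) * u0 + b 1%N * u1 = - (b 3%N * u' 3%N).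
    by apply/eqP; rewrite -addr_eq0 -[X in _ == X]us; apply/eqP; ring.
  have u3 := norm1_conj (u'1 3%N isT).
  rewrite rmorphN rmorphM mulrNN /=.
  by transitivity (b 3%N * (b 3%N)^* * (u' 3%N * (u' 3%N)^*)); [ring|rewrite u3 mulr1].
have [q [qm q2]] : exists q, m = q.+1 /\ (1 < q)%N by exists m.-1; lia.
subst m.
pose X (k : 'I_n) := w ^+ k.
have Xi : injective X := powers_inj pw; have X0 k : X k != 0 := powers_neq0 pw k.
pose r (u : nat -> C) j := \sum_(i < j) b i * u i.
pose T1 := b q.+1 * (b q.+1)^*; pose T2 := b q.+2 * (b q.+2)^*.
pose inv (u : nat -> C) i := (u i)^-1.
(* Inverse values are controlled too, because the roles of [x] and [y] will be exchanged. The moduli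
   [T1] and [T2] are those [last_two_rows] forbids for [r]; at [j = 1] the modulus of [r] is that of
   [b 0] and cannot be influenced, hence the condition [1 < j]. *)
pose Q j (u : nat -> C) := [/\ forall l, independent X u j l, forall l, independent X (inv u) j l,
   (0 < j)%N -> r u j != 0 & (1 < j)%N -> r u j * (r u j)^* != T1 /\ r u j * (r u j)^* != T2].
have [||j u jq Su [i1 i2 rn rT]|u [Su [i1 i2 rn rT]]] := @generic_choice _ S Q (fun=> 0) q.
- by move=> i iq; apply: Sinf; lia.
- by split=> // l; apply: independent0.
- have [L1 HL1] := independentS Xi X0 i1; have [L2 HL2] := independentS Xi X0 i2.
  have [L3 HL3] : exists L : seq C, forall v, `|v| = 1 -> (0 < j)%N ->
      [\/ r u j + b j * v = 0, (r u j + b j * v) * (r u j + b j * v)^* = T1 |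
          (r u j + b j * v) * (r u j + b j * v)^* = T2] -> v \in L.
    have [j0|j0] := posnP j; first by exists [::].
    have bj : b j != 0 by apply: b0; lia.
    have [La Ha] := circle_finite 0 (rn j0) bj; have [Lb Hb] := circle_finite T1 (rn j0) bj.
    have [Lc Hc] := circle_finite T2 (rn j0) bj.
    exists (La ++ Lb ++ Lc) => v v1 _; rewrite !mem_cat => -[e|e|e].
    + by rewrite Ha // e mul0r.
    + by rewrite Hb ?orbT.
    + by rewrite Hc ?orbT.
  exists (L1 ++ [seq x^-1 | x <- L2] ++ L3) => u' u'u Su'; rewrite !mem_cat !negb_or => /and3P[n1 n2 n3].
  have v1 := S1 _ _ Su'.
  have er : r u' j.+1 = r u j + b j * u' j.
    by rewrite /r big_ord_recr /=; congr (_ + _); apply: eq_bigr => i _; rewrite u'u.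
  have rj0 : r u' j.+1 != 0.
    have [j0|j0] := posnP j.
      rewrite er j0 /r big_ord0 add0r mulf_neq0 ?b0 //; first by rewrite -normr_eq0 -{1}j0 v1 oner_eq0.
    by apply: contraNneq n3; rewrite er => e; apply: HL3 => //; apply: Or31.
  split=> //; first exact: HL1.
    apply: HL2 => [i ij|]; first by rewrite /inv u'u.
    apply: contra n2 => h; apply/mapP; exists (inv u' j) => //; by rewrite /inv invrK.
  rewrite ltnS => j0; rewrite er; split; apply: contraNneq n3 => e; apply: HL3 => //.
    exact: Or32.
  exact: Or33.
have [rT1 rT2] := rT q2; have r0 := rn (ltnW q2).
have bq : b q != 0 by apply: b0; lia.
have bq1 : b q.+1 != 0 by apply: b0; lia.
have [L1 H1] := @last_two_rows _ _ X u q (b q) (b q.+1) (b q.+2) (r u q) (i1 2%N) bq bq1 r0 rT2 rT1.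
(* On the unit circle inversion is conjugation, so the inverse values satisfy the conjugated linear
   relation. *)
have [|||||L2 H2] := @last_two_rows _ _ X (inv u) q (b q)^* (b q.+1)^* (b q.+2)^* (r u q)^* (i2 2%N);
  rewrite ?conjC_eq0 ?conjCK //.
- by rewrite mulrC [(b q.+2)^* * _]mulrC.
- by rewrite mulrC [(b q.+1)^* * _]mulrC.
have [v Sv] := Sinf q (ltnSn q) (L1 ++ [seq x^-1 | x <- L2]).
rewrite mem_cat negb_or => /andP[vL1 vL2].
exists (fun j => if j == q then v else u j); split.
  move=> j; rewrite ltnS leq_eqVlt; case: eqVneq => [-> //|_ /= jq]; exact: Su.
move=> u' uu' u'1 usum x y wxy h.
have eu j : (j < q)%N -> u' j = u j by move=> jq; rewrite uu' ?(ltn_eqF jq) // ltnW.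
have ev : u' q = v by rewrite uu' // eqxx.
have u'n j : (j <= q.+2)%N -> u' j != 0 by move=> /u'1 e; rewrite -normr_eq0 e oner_eq0.
have {}h j : (j <= q.+2)%N -> expsum X x j = u' j * expsum X y j.
  by move=> jq; rewrite h // (interp_eval inj).
have rel : b q * v + r u q + b q.+1 * u' q.+1 + b q.+2 * u' q.+2 = 0.
  move: usum; rewrite !big_ord_recr /= ev => us; rewrite -[RHS]us.
  rewrite [_ + r u q]addrC; congr (_ + _ + _ + _).
  by apply: eq_bigr => i _; rewrite eu.
have v1 : `|v| = 1 by rewrite -ev; apply: u'1; rewrite ltnW.
have nU := u'1 q.+1 (leqnSn _); have nV := u'1 q.+2 (leqnn _).
have leq2 i : (i <= q)%N -> (i <= q.+2)%N by move=> iq; apply: leq_trans iq _; rewrite ltnW.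
have [wx|wx] := leqP (weight x) q.
  apply: (H1 v vL1 v1 _ _ nU nV rel x y wx wxy).
  - by move=> i iq; rewrite h ?eu // leq2 // ltnW.
  - by rewrite h ?ev // leq2.
  - by rewrite h.
suff: (forall k, y k = 0) /\ (forall k, x k = 0) by case.
have vinv : v^-1 \notin L2.
  by apply: contra vL2 => hv; apply/mapP; exists v^-1; rewrite ?invrK.
have relc : (b q)^* * v^-1 + (r u q)^* + (b q.+1)^* * (u' q.+1)^-1 + (b q.+2)^* * (u' q.+2)^-1 = 0.
  rewrite -(conj_norm1 v1) -(conj_norm1 nU) -(conj_norm1 nV).
  by rewrite -!rmorphM -!rmorphD /= rel conjC0.
have wyx : (weight y + weight x <= q.+2)%N by rewrite addnC.
have wy : (weight y <= q)%N.
  by move: wyx wx q2; move: (weight x) (weight y) => a c; clear; lia.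
have inv1 (z : C) : `|z| = 1 -> `|z^-1| = 1 by move=> e; rewrite normfV e invr1.
apply: (H2 v^-1 vinv (inv1 _ v1) _ _ (inv1 _ nU) (inv1 _ nV) relc y x wy wyx).
- by move=> i iq; rewrite /inv h -?eu // ?mulKf ?u'n // leq2 // ltnW.
- by rewrite h ?ev ?mulKf -?ev ?u'n // leq2.
- by rewrite h ?mulKf ?u'n.
Qed.

End Generic.

Lemma exists_last_party_polynomial n s : (3 <= s)%N -> (s < n)%N -> exists (w : C) (f : {poly C}),
  [/\ n.-primitive_root w, (size f <= s)%N, forall j, (j <= s)%N -> `|f.[w ^+ j]| = 1,
      forall j, (s < j < n)%N -> `|f.[w ^+ j]| < 1 & nondegenerate n w s f].
Proof.
move=> s3 sn; have [|w pw ext] := @extremal_root C n; first by lia.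
have [/andP[/eqP -> /eqP n4]|h] := boolP ((s == 3%N) && (n == 4%N)).
  subst n; have [f [h1 h2 h3]] := exists_polynomial4 pw.
  by exists w, f; split=> // j; lia.
have [|f [h1 h2 h3 h4]] := exists_polynomial_extremal pw ext s3 sn; last by exists w, f.
by move: h sn => /nandP[/negPf ->//|h] sn e; lia.
Qed.

End PolynomialExistence.

(** * Product vectors and parties *)

Section InnerProduct.
Local Open Scope ring_scope.
Variable C : numClosedFieldType.

Lemma hinner_sym n (x y : 'rV[C]_n) : hinner y x = (hinner x y)^*.
Proof.
rewrite /hinner raddf_sum; apply: eq_bigr => i _ /=.
by rewrite rmorphM /= conjCK mulrC.
Qed.

Lemma hinner_self_gt0 n (x : 'rV[C]_n) : (0 < hinner x x) = (x != 0).
Proof.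
have ge0 (i : 'I_n) : 0 <= (x 0 i)^* * x 0 i by rewrite mulrC mul_conjC_ge0.
rewrite lt0r sumr_ge0 ?andbT //; congr negb; apply/eqP/eqP => [|->].
  move/eqP; rewrite psumr_eq0 // => /allP h; apply/rowP => i; rewrite mxE.
  by have := h i (mem_index_enum i); rewrite /= mulrC mul_conjC_eq0 => /eqP.
by rewrite /hinner big1 // => i _; rewrite mxE mulr0.
Qed.

Lemma hinnerZ n a (x y : 'rV[C]_n) : hinner (a *: x) y = a^* * hinner x y.
Proof. by rewrite /hinner mulr_sumr; apply: eq_bigr => i _; rewrite mxE rmorphM /= mulrA. Qed.

Lemma hinnerZr n a (x y : 'rV[C]_n) : hinner x (a *: y) = a * hinner x y.
Proof. by rewrite hinner_sym hinnerZ rmorphM /= conjCK -hinner_sym. Qed.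

Lemma pairwise_mapT (T : eqType) S (f : T -> S) (r : rel S) (s : seq T) : uniq s ->
  (forall x y, x != y -> r (f x) (f y)) -> pairwise r (map f s).
Proof.
move=> us h; rewrite pairwise_map; elim: s us => //= a s IH /andP[as_ us]; rewrite IH // andbT.
by apply/allP => b bs /=; apply: h; apply: contraNneq as_ => ->.
Qed.

(* A product vector is orthogonal to a product vector of the family iff some factor is;
   at party [j] this happens at most [cap j] times. *)
Lemma upb_of_family p d (V : finType) (x : V -> pvec C p d) (cap : 'I_p -> nat) :
  (forall v j, x v j != 0) ->
  (forall v v', v != v' -> exists j, hinner (x v j) (x v' j) = 0) ->
  (forall (j : 'I_p) (y : 'rV[C]_(d j)), y != 0 -> (#|[set v | hinner (x v j) y == 0%R]| <= cap j)%N) ->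
  (\sum_j cap j < #|V|)%N ->
  exists S : seq (pvec C p d), isUPB S /\ size S = #|V|.
Proof.
move=> x0 orth hcap hV.
pose nz v j := (sqrtC (hinner (x v j) (x v j)))^-1 *: x v j.
have sq v j : 0 < sqrtC (hinner (x v j) (x v j)) by rewrite sqrtC_gt0 hinner_self_gt0.
have sr v j : (sqrtC (hinner (x v j) (x v j)))^-1 ^* = (sqrtC (hinner (x v j) (x v j)))^-1.
  by apply/CrealP/gtr0_real; rewrite invr_gt0.
have orth_nz v (j : 'I_p) (y : 'rV[C]_(d j)) : (hinner (nz v j) y == 0) = (hinner (x v j) y == 0).
  by rewrite hinnerZ sr mulf_eq0 invr_eq0 (gt_eqF (sq v j)).
exists [seq (nz v : pvec C p d) | v <- enum V]; split; last by rewrite size_map -cardE.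
split.
- rewrite all_map; apply/allP => v _ /=; apply/andP; split.
    by apply/forallP => j; rewrite scaler_eq0 invr_eq0 (gt_eqF (sq v j)) x0.
  rewrite /pinner big1 // => j _; rewrite hinnerZ hinnerZr sr mulrA -expr2 exprVn sqrtCK.
  by rewrite mulVf // gt_eqF // hinner_self_gt0.
- apply: pairwise_mapT; first exact: enum_uniq.
  move=> v v' /orth[j hj]; rewrite /pinner (bigD1 j) //= mulf_eq0; apply/orP; left.
  by rewrite orth_nz hinnerZr hj mulr0.
move=> y ny; apply: contraTT hV; rewrite -all_predC all_map -leqNgt => /allP h.
have cover v : (1 <= \sum_(j < p) (hinner (x v j) (y j) == 0%R))%N.
  have := h v; rewrite mem_enum => /(_ isT) /=; rewrite negbK /pinner prodf_seq_eq0.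
  case/hasP => j _ /=; rewrite orth_nz => hj; by rewrite (bigD1 j) //= hj.
have total : (#|V| <= \sum_v \sum_(j < p) (hinner (x v j) (y j) == 0%R))%N.
  by rewrite -sum1_card; apply: leq_sum => v _; apply: cover.
apply: leq_trans total _; rewrite exchange_big; apply: leq_sum => j _.
apply: leq_trans (hcap j (y j) _); last by have /forallP := ny; apply.
by rewrite -sum1dep_card [leqRHS]big_mkcond /=; apply: leq_sum => v _; case: ifP.
Qed.

End InnerProduct.

Lemma big_pair_bool (R : Type) (idx : R) (op : Monoid.com_law idx) (I : finType) (F : bool * I -> R) :
  \big[op/idx]_v F v = op (\big[op/idx]_k F (true, k)) (\big[op/idx]_k F (false, k)).
Proof.
rewrite (eq_bigr (fun v => F (v.1, v.2))); last by case.
by rewrite -(pair_bigA _ (fun b k => F (b, k))) big_bool.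
Qed.

Lemma card_sum (T : finType) (P : pred T) : #|[set k | P k]| = \sum_k (P k : nat).
Proof. by rewrite -sum1dep_card big_mkcond; apply: eq_bigr => k _; case: (P k). Qed.

Section Parties.
Local Open Scope ring_scope.
Variables (C : numClosedFieldType) (n : nat) (w : C).
Hypothesis pw : n.-primitive_root w.

Lemma exprV_inj i j : (i < n)%N -> (j < n)%N -> w^-1 ^+ i = w^-1 ^+ j -> i = j.
Proof. by move=> hi hj; rewrite !exprVn => /invr_inj; apply: (prim_inj pw). Qed.

(* Coefficients of the q-binomial product do not vanish, since a vanishing one would give
   a sum of [m] exponentials with [m] consecutive zeros. *)
Lemma qbinomial_coef_neq0 m o a : (m < n)%N -> (a <= m)%N ->
  (\prod_(t < m) ('X - (w^-1 ^+ (o + t))%:P))`_a != 0.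
Proof.
move=> mn am; set P := \prod_(t < m) _.
have sP : size P = m.+1 by rewrite /P -big_enum size_prod_XsubC size_enum_ord.
have lP : P`_m = 1.
  have : lead_coef P = 1 by apply/monicP/monic_prod_XsubC.
  by rewrite lead_coefE sP.
apply/negP => /eqP Pa.
pose X (k : 'I_m.+1) := w^-1 ^+ k.
have Xi : injective X.
  by move=> k l e; apply/val_inj/(exprV_inj _ _ e); apply: leq_trans (ltn_ord _) _.
have X0 k : X k != 0 by rewrite /X exprVn invr_eq0 (prim_neq0 pw).
have : forall k : 'I_m.+1, P`_k = 0.
  apply: (vandermonde Xi X0 (i := o) (l := m)) => [|i hi].
  - apply: leq_trans (weight_sub (A := [set~ inord a]) _) _.
      by move=> k; rewrite !inE negbK => /eqP ->; rewrite inordK.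
    by rewrite cardsC1 card_ord.
  - have -> : expsum X (fun k => P`_k) i = P.[w^-1 ^+ i].
      rewrite (@horner_coef_wide _ m.+1) ?sP //; apply: eq_bigr => k _.
      by rewrite /X exprAC.
    rewrite horner_prod; apply/eqP; rewrite prodf_seq_eq0; apply/hasP.
    have im : (i - o < m)%N by lia.
    exists (Ordinal im); rewrite ?mem_index_enum //= hornerXsubC subnKC ?subrr //; lia.
by move/(_ ord_max)/eqP; rewrite /= lP oner_eq0.
Qed.

(** The label [false] stands for left and [true] for right. The weights [xi a] cancel in left-right
    inner products, which become values of [P] at [w^(k'-k)]. They do enter the linear dependences
    among [D] vectors, as the generic values [u a = - P_a xi_a^2] of [independent]. *)
Lemma generic_party D o : (0 < D)%N -> (D <= n)%N ->
  exists vec : bool * 'I_n -> 'rV[C]_D, [/\ forall v, vec v != 0,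
    forall (k k' : 'I_n) t, (o <= t < o + D.-1)%N -> w ^+ k = w ^+ (k' + t) ->
      hinner (vec (false, k)) (vec (true, k')) = 0 &
    forall y, y != 0 -> (#|[set v | hinner (vec v) y == 0%R]| <= D.-1)%N].
Proof.
case: D => // m _ mn /=.
pose P := \prod_(t < m) ('X - (w^-1 ^+ (o + t))%:P).
have sP : size P = m.+1 by rewrite /P -big_enum size_prod_XsubC size_enum_ord.
have P0 a : (a <= m)%N -> P`_a != 0 by apply: qbinomial_coef_neq0.
pose X (k : 'I_n) := (w ^+ k)^*.
have Xi : injective X by move=> k l /(can_inj (@conjCK _)) /(prim_inj pw (ltn_ord k) (ltn_ord l)) /val_inj.
have X0 k : X k != 0 by rewrite conjC_eq0 (prim_neq0 pw).
(* Positivity of [- u a / P_a] makes [xi a] a positive real number. *)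
have [|u [Su ind]] := independent_exists Xi X0 (S := fun a v => 0 < - v / P`_a) (m := m.+1).
  move=> a am; apply: (infinite_injective (f := fun k => - P`_a * k.+1%:R)) => [k l|k].
    move/(mulfI _); rewrite oppr_eq0 => /(_ (P0 a am)) /eqP; rewrite eqr_nat eqSS.
    by move/eqP.
  have -> : - (- P`_a * k.+1%:R) / P`_a = k.+1%:R.
    by have := P0 a am; move: (P`_a) (k.+1%:R : C) => p q p0; field.
  by rewrite ltr0n.
pose xi a := sqrtC (- u a / P`_a).
have xi0 a : (a <= m)%N -> 0 < xi a by move=> am; rewrite sqrtC_gt0 Su.
have uE a : (a <= m)%N -> u a = - (P`_a * xi a * xi a).
  move=> am; rewrite -mulrA -expr2 sqrtCK.
  by have := P0 a am; move: (P`_a) (u a) => p q p0; field.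
pose ent (v : bool * 'I_n) (a : nat) := if v.1 then (xi a)^-1 * w ^+ (a * v.2) else (P`_a)^* * xi a * w ^+ (a * v.2).
have xic a : (a <= m)%N -> (xi a)^* = xi a by move=> am; apply/CrealP/gtr0_real/xi0.
have xin a : (a <= m)%N -> xi a != 0 by move=> am; rewrite gt_eqF ?xi0.
exists (fun v => \row_(a < m.+1) ent v a); split.
- move=> v; apply/negP => /eqP /rowP /(_ ord0); rewrite !mxE /ent /= mul0n expr0 !mulr1.
  by move/eqP; case: ifP => _; rewrite ?invr_eq0 ?mulf_eq0 ?conjC_eq0 ?(negPf (P0 _ _)) ?(negPf (xin _ _)).
- move=> k k' t ht e.
  transitivity (P.[w ^+ k' / w ^+ k]).
    rewrite (@horner_coef_wide _ m.+1) ?sP //.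
    apply: eq_bigr => a _; rewrite !mxE /ent /=.
    have am : (a <= m)%N by rewrite -ltnS.
    rewrite !rmorphM /= conjCK xic // conj_norm1 ?(prim_norm pw) // expr_div_n -!exprM.
    rewrite ![(a * _)%N]mulnC; have := prim_neq0 pw (k * a).
    by move: (w ^+ (k * a)) (w ^+ (k' * a)) => p q p0; field; rewrite xin // p0.
  rewrite horner_prod; apply/eqP; rewrite prodf_seq_eq0; apply/hasP.
  have im : (t - o < m)%N by lia.
  exists (Ordinal im); rewrite ?mem_index_enum //= hornerXsubC subnKC; last by lia.
  rewrite e exprVn exprD invfM mulrA divff ?(prim_neq0 pw) // mul1r subrr //.
move=> y y0; rewrite leqNgt; apply/negP => big.
set F := [set v | _] in big.
(* Among the orthogonal vertices exactly [m.+1] are kept, so that the matrix is square and a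
   dependence of its rows suffices for the contradiction. *)
have [E EF cE] : exists2 E : {set bool * 'I_n}, E \subset F & #|E| = m.+1.
  exists [set:: take m.+1 (enum F)].
    by apply/subsetP => v; rewrite inE => /mem_take; rewrite mem_enum.
  rewrite cardsE (card_uniqP _) ?take_uniq ?enum_uniq //.
  by rewrite size_takel // -cardE.
pose M : 'M[C]_(#|E|, m.+1) := \matrix_(i, a) (ent (enum_val i) a)^*.
have My : M *m y^T = 0.
  apply/colP => i; rewrite !mxE.
  have := subsetP EF _ (enum_valP i); rewrite inE => /eqP e; rewrite -[RHS]e.
  by apply: eq_bigr => a _; rewrite !mxE.
suff fM : row_full M.
  case/negP: y0; apply/eqP; rewrite -[y]trmxK -[RHS]trmx0; congr (_^T).
  by apply: (row_full_inj fM); rewrite My mulmx0.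
suff : row_free M by rewrite /row_free /row_full => /eqP ->; rewrite cE.
apply: inj_row_free => c cM.
pose coef v := \sum_i c 0 i * (enum_val i == v)%:R.
have coefE i : coef (enum_val i) = c 0 i.
  rewrite /coef (bigD1 i) //= eqxx mulr1 big1 ?addr0 // => i' ne.
  by rewrite (inj_eq enum_val_inj) (negPf ne) mulr0.
have coef0 v : v \notin E -> coef v = 0.
  move=> vE; apply: big1 => i _; case: eqP => e; rewrite ?mulr0 //.
  by rewrite -e enum_valP in vE.
pose x k := coef (true, k); pose z k := coef (false, k).
have sumE (G : bool * 'I_n -> C) :
    \sum_i c 0 i * G (enum_val i) = \sum_k x k * G (true, k) + \sum_k z k * G (false, k).
  transitivity (\sum_v coef v * G v).
    under [RHS]eq_bigr do rewrite mulr_suml.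
    rewrite exchange_big /=; apply: eq_bigr => i _.
    rewrite (bigD1 (enum_val i)) //= eqxx mulr1 big1 ?addr0 // => v ne.
    by rewrite eq_sym (negPf ne) mulr0 mul0r.
  by rewrite big_pair_bool.
have wxz : (weight x + weight z <= m.+1)%N.
  rewrite -cE /weight !card_sum -[#|E|]cardsE card_sum.
  rewrite big_pair_bool /=.
  by apply: leq_add; apply: leq_sum => k _; case: eqVneq => // h; rewrite lt0b;
    apply: contraT => /coef0 e; rewrite /x /z e eqxx in h.
have [|||x0 z0] := ind 0%N x z; rewrite ?addn0 //.
- exact: leq_trans (leq_addr _ _) wxz.
- split=> [a am|a]; last by rewrite addn0 ltnNge andNb.
  have := congr1 (fun r : 'rV_m.+1 => r 0 (Ordinal am)) cM; rewrite !mxE.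
  under eq_bigr do rewrite mxE.
  rewrite (sumE (fun v => (ent v a)^*)) /ent /= => e.
  have xa := xin _ (ltnSE am).
  have e1 : (xi a)^-1 * expsum X x a + P`_a * xi a * expsum X z a = 0.
    rewrite -[RHS]e /expsum !mulr_sumr; congr (_ + _); apply: eq_bigr => k _.
      by rewrite rmorphM fmorphV /= xic // /X -rmorphXn -exprM mulnC; ring.
    by rewrite !rmorphM /= conjCK xic // /X -rmorphXn -exprM mulnC; ring.
  rewrite uE //; apply: (mulfI (invr_neq0 xa)); apply/eqP; rewrite -subr_eq0; apply/eqP.
  by rewrite -[RHS]e1; field.
apply/rowP => i; rewrite !mxE -coefE; case: (enum_val i) => -[] k; [exact: x0|exact: z0].
Qed.

End Parties.

(** * Vectors of the last party *)

Section LastParty.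
Local Open Scope ring_scope.
Variables (C : numClosedFieldType) (n : nat) (w : C).
Hypothesis pw : n.-primitive_root w.

Lemma sum_unity (z : C) : z ^+ n = 1 -> \sum_(j < n) z ^+ j = if z == 1 then n%:R else 0.
Proof.
move=> zn; case: eqVneq => [->|z1].
  under eq_bigr do rewrite expr1n.
  by rewrite sumr_const card_ord.
have := subrX1 z n; rewrite zn subrr => /esym/eqP.
by rewrite mulf_eq0 subr_eq0 (negPf z1) => /eqP.
Qed.

(** Left vectors are the discrete exponentials, padded by zeros; right ones are multiplied by [F]
    and completed by [G] with [|F|^2 + |G|^2 = 1], which restores orthogonality on their side. Since
    [|F| = 1] at [s.+1] nodes, only [n - s.+1] extra coordinates are needed, which gives the
    dimension [D]. *)
Lemma last_party D s (f : {poly C}) : (s < n)%N -> (D + s.+1 = n + n)%N -> (size f <= s)%N ->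
  (forall j, (j <= s)%N -> `|f.[w ^+ j]| = 1) ->
  (forall j, (s < j < n)%N -> `|f.[w ^+ j]| < 1) -> nondegenerate n w s f ->
  exists vec : bool * 'I_n -> 'rV[C]_D, [/\ forall v, vec v != 0,
    forall b (k k' : 'I_n), k != k' -> hinner (vec (b, k)) (vec (b, k')) = 0,
    forall k k' : 'I_n, (forall t, (t < s)%N -> w ^+ k != w ^+ (k' + t)) ->
      hinner (vec (false, k)) (vec (true, k')) = 0 &
    forall y, y != 0 -> (#|[set v | hinner (vec v) y == 0%R]| <= D)%N].
Proof.
move=> sn eD sf f1 flt nd.
have n0 := prim_order_gt0 pw.
have nD : (n <= D)%N by lia.
have w0 k : w ^+ k != 0 := prim_neq0 pw k.
pose F j := f.[w ^+ j]; pose G j := sqrtC (1 - F j * (F j)^*).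
(* Coordinates [n .. D - 1] carry the exponents [s.+1 .. n - 1]. *)
pose sh i := (i + s.+1 - n)%N.
pose ent (v : bool * 'I_n) i := if (i < n)%N then (if v.1 then F i else 1) * w ^+ (i * v.2)
  else (if v.1 then G (sh i) else 0) * w ^+ (sh i * v.2).
pose vec v : 'rV[C]_D := \row_(i < D) ent v i.
have split_sum (H : nat -> C) : \sum_(i < D) H i = \sum_(j < n) H j + \sum_(s.+1 <= j < n) H (j + n - s.+1)%N.
  rewrite -!(big_mkord xpredT) (big_cat_nat (leq0n n) nD) //=; congr (_ + _).
  transitivity (\sum_(0 <= i < D - n) H (i + n)%N); first exact: (big_addn 0 D n xpredT H).
  symmetry; apply: (etrans (big_addn 0 n s.+1 xpredT _)).
  have -> : (D - n = n - s.+1)%N by lia.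
  by apply: eq_bigr => i _; congr H; lia.
have head_tail (H : nat -> C) :
    \sum_(j < n) H j = \sum_(0 <= j < s.+1) H j + \sum_(s.+1 <= j < n) H j.
  by rewrite -(big_mkord xpredT) (big_cat_nat (leq0n s.+1) sn).
have shK j : (s < j)%N -> sh (j + n - s.+1)%N = j by rewrite /sh; lia.
have ge_n j : (s < j)%N -> ((j + n - s.+1)%N < n)%N = false by lia.
have GG j : (s < j < n)%N -> (G j)^* * G j = 1 - F j * (F j)^*.
  move=> jn; have lt1 : F j * (F j)^* < 1.
    by rewrite -normCK expr_lt1 // flt.
  by rewrite (CrealP _) -?expr2 ?sqrtCK // ger0_real // sqrtC_ge0 subr_ge0 ltW.
have G0 j : (s < j < n)%N -> G j != 0.
  move=> jn; rewrite sqrtC_eq0 subr_eq0 eq_sym lt_eqF // -normCK expr_lt1 // flt //.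
have FF j : (j <= s)%N -> F j * (F j)^* = 1 by move=> js; apply: norm1_conj; apply: f1.
pose z (k k' : 'I_n) : C := w ^+ k' / w ^+ k.
have zE (k k' : 'I_n) (j : nat) : (w ^+ (j * k))^* * w ^+ (j * k') = z k k' ^+ j.
  by rewrite conj_norm1 ?(prim_norm pw) // /z expr_div_n -!exprM ![(j * _)%N]mulnC mulrC.
have zn k k' : z k k' ^+ n = 1.
  by rewrite /z expr_div_n -!exprM ![(_ * n)%N]mulnC !exprM (prim_expr_order pw) !expr1n divr1.
have z1 k k' : k != k' -> z k k' != 1.
  apply: contra => /eqP e; apply/eqP/val_inj/(prim_inj pw (ltn_ord _) (ltn_ord _)).
  by rewrite -[RHS](divfK (w0 k)) -/(z k k') e mul1r.
have innerE v v' : hinner (vec v) (vec v') = \sum_(j < n) ((if v.1 then F j else 1)^* * (if v'.1 then F j else 1)) * z v.2 v'.2 ^+ j +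
    \sum_(s.+1 <= j < n) ((if v.1 then G j else 0)^* * (if v'.1 then G j else 0)) * z v.2 v'.2 ^+ j.
  transitivity (\sum_(i < D) (ent v i)^* * ent v' i).
    by apply: eq_bigr => i _; rewrite !mxE.
  rewrite (split_sum (fun i => (ent v i)^* * ent v' i)); congr (_ + _).
    apply: eq_bigr => j _; rewrite /ent ltn_ord -zE rmorphM /=; ring.
  apply: eq_big_nat => j /andP[sj jn]; rewrite /ent ge_n // shK // -zE rmorphM /=; ring.
exists vec; split.
- move=> [b k]; apply/negP => /eqP /rowP.
  have D0 : (0 < D)%N by lia.
  move/(_ (Ordinal D0)); rewrite !mxE /ent /= n0 mul0n expr0 mulr1 => /eqP.
  by case: b; rewrite ?oner_eq0 // -normr_eq0 f1 // oner_eq0.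
- move=> b k k' kk'; rewrite innerE /=; have s0 : \sum_(j < n) z k k' ^+ j = 0.
    by rewrite sum_unity // (negPf (z1 _ _ kk')).
  case: b; last first.
    rewrite [X in _ + X]big1 => [|j _]; last by rewrite mulr0 mul0r.
    by rewrite addr0 -[RHS]s0; apply: eq_bigr => j _; rewrite conjC1 !mul1r.
  rewrite -[RHS]s0 (head_tail (fun j => (F j)^* * F j * z k k' ^+ j)).
  rewrite (head_tail (fun j => z k k' ^+ j)) -addrA -big_split /=; congr (_ + _).
    by apply: eq_big_nat => j /andP[_ js]; rewrite mulrC [_^* * _]mulrC FF // mulr1.
  by apply: eq_big_nat => j js; rewrite GG //; ring.
- move=> k k' ht; rewrite innerE /= [X in _ + X]big1 => [|j _]; last by rewrite conjC0 !mul0r.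
  rewrite addr0; under eq_bigr do rewrite conjC1 mul1r /F (horner_coef_wide _ sf) mulr_suml.
  rewrite exchange_big big1 //= => t _.
  transitivity (f`_t * \sum_(j < n) (w ^+ t * z k k') ^+ j).
    by rewrite mulr_sumr; apply: eq_bigr => j _; rewrite [(_ * z k k') ^+ j]exprMn mulrA exprAC.
  rewrite sum_unity; last by rewrite exprMn zn mulr1 exprAC (prim_expr_order pw) expr1n.
  rewrite ifF ?mulr0 //; apply/negP => /eqP e; have := ht t (ltn_ord t).
  case/negP; apply/eqP; rewrite -[LHS]mul1r -e /z mulrA divfK // exprD mulrC //.
move=> y y0; rewrite leqNgt; apply/negP => big.
pose yn i := if insub i is Some i' then y 0 (i' : 'I_D) else 0.
have ynE (i : 'I_D) : yn i = y 0 i by rewrite /yn valK.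
pose Y v := hinner (vec v) y.
have YE v : Y v = \sum_(j < n) ((if v.1 then F j else 1)^* * (w ^+ (j * v.2))^*) * yn j +
   \sum_(s.+1 <= j < n) ((if v.1 then G j else 0)^* * (w ^+ (j * v.2))^*) * yn (j + n - s.+1)%N.
  transitivity (\sum_(i < D) (ent v i)^* * yn i).
    by apply: eq_bigr => i _; rewrite !mxE ynE.
  rewrite (split_sum (fun i => (ent v i)^* * yn i)); congr (_ + _).
    by apply: eq_bigr => j _; rewrite /ent ltn_ord rmorphM.
  by apply: eq_big_nat => j /andP[sj jn]; rewrite /ent ge_n // shK // rmorphM.
have tail (H : nat -> C) : \sum_(s.+1 <= j < n) H j = \sum_(j < n) (if (s < j)%N then H j else 0).
  rewrite -(big_mkord xpredT (fun j => if (s < j)%N then H j else 0)).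
  rewrite [RHS](big_cat_nat (leq0n s.+1) sn) /= [X in _ = X + _]big1_seq ?add0r.
    by apply: eq_big_nat => j /andP[-> _].
  by move=> j /andP[_]; rewrite mem_index_iota => /andP[_ js]; rewrite ifF // ltnNge -ltnS js.
pose B (b : bool) j := (if b then F j else 1)^* * yn j +
  (if (s < j)%N then (if b then G j else 0)^* * yn (j + n - s.+1)%N else 0).
have YB b k : Y (b, k) = \sum_(j < n) B b j * (w ^+ (j * k))^*.
  rewrite YE tail -big_split /=; apply: eq_bigr => j _; rewrite /B mulrDl; congr (_ + _).
    by ring.
  by case: ifP => _; rewrite ?mul0r //; ring.
pose X (k : 'I_n) := w ^+ k.
have nn0 : n%:R != 0 :> C by rewrite pnatr_eq0 -lt0n.
(* Fourier inversion on [Z/n]: up to the index [s] the transforms of the left and right inner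
   products with [y] differ exactly by the factor [F], which is the system in [nondegenerate]. *)
have fourier b i : (i < n)%N -> expsum X (fun k => Y (b, k)) i = n%:R * B b i.
  move=> hi; rewrite /expsum; under eq_bigr do rewrite YB mulr_suml.
  rewrite exchange_big /= (bigD1 (Ordinal hi)) //= [X in _ + X]big1 ?addr0 => [|j ne].
    rewrite (eq_bigr (fun=> B b i)) ?sumr_const ?card_ord ?mulr_natl // => k _.
    rewrite -mulrA /X -exprM [(k * i)%N]mulnC mulrC [_^* * _]mulrC norm1_conj ?mul1r //.
    exact: (prim_norm pw).
  transitivity (B b j * \sum_(k < n) (z j (Ordinal hi)) ^+ k).
    by rewrite mulr_sumr; apply: eq_bigr => k _; rewrite -mulrA -zE /X -exprM ![(k * _)%N]mulnC.
  by rewrite sum_unity // (negPf (z1 _ _ ne)) mulr0.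
(* More than [D] of the [2n] inner products vanish, so at most [2n - D - 1 = s] do not. *)
have wsum : (weight (fun k => Y (false, k)) + weight (fun k => Y (true, k)) <= s)%N.
  have tot : (#|[set v | Y v == 0%R]| + #|[set v | Y v != 0%R]| = n + n)%N.
    have -> : [set v | Y v != 0%R] = ~: [set v | Y v == 0%R] by apply/setP => v; rewrite !inE.
    by rewrite cardsC card_prod card_bool card_ord mul2n addnn.
  have : #|[set v | Y v != 0%R]| = (weight (fun k => Y (true, k)) + weight (fun k => Y (false, k)))%N.
    by rewrite /weight !card_sum big_pair_bool.
  have {}big : (D < #|[set v | Y v == 0%R]|)%N by exact: big.
  by move=> e; move: tot big; rewrite e; lia.
have [i is_|l0 r0] := nd (fun k => Y (false, k)) (fun k => Y (true, k)) wsum.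
  have hi : (i < n)%N by apply: leq_ltn_trans is_ sn.
  rewrite (fourier false i hi) (fourier true i hi) /B ltnNge is_ /= !addr0 conjC1 mul1r.
  by rewrite -/(F i) mulrCA [F i * _]mulrA FF // mul1r.
have B0 b j : (j < n)%N -> B b j = 0.
  move=> hj; apply: (mulfI nn0); rewrite mulr0 -fourier // expsum0 //.
  by case: b; [exact: r0|exact: l0].
have yn0 j : (j < n)%N -> yn j = 0.
  move=> hj; have := B0 false j hj; rewrite /B conjC1 mul1r conjC0 mul0r; by case: ifP; rewrite addr0.
case/negP: y0; apply/eqP/rowP => i; rewrite mxE -ynE.
have [lt|ge] := ltnP i n; first exact: yn0.
have iD := ltn_ord i.
pose j := (i + s.+1 - n)%N; have jn : (j < n)%N by rewrite /j; lia.
have sj : (s < j)%N by rewrite /j; lia.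
have := B0 true j jn; rewrite /B yn0 // mulr0 add0r sj => /eqP.
rewrite mulf_eq0 conjC_eq0 (negPf (G0 j _)) ?sj //= => /eqP e.
by rewrite -[RHS]e; congr yn; rewrite /j; lia.
Qed.

End LastParty.

(** * Assembling the unextendible product basis *)

Section UpperBound.
Variables (C : numClosedFieldType) (d : nat -> nat).

Lemma consecutive_block (m : nat -> nat) q t : t < \sum_(0 <= i < q) m i ->
  exists2 j, j < q & \sum_(0 <= i < j) m i <= t < \sum_(0 <= i < j) m i + m j.
Proof.
elim: q => [|q IH]; first by rewrite big_geq.
rewrite big_nat_recr //=; have [lt|ge] := ltnP t (\sum_(0 <= i < q) m i).
  by have [j jq hj] := IH lt; exists j => //; apply: ltnW.
by move=> lt; exists q; rewrite ?ge.
Qed.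

Lemma upb_exists q : (forall j, j < q.+1 -> 2 <= d j) ->
  \sum_(0 <= j < q) (d j - 1) <= d q - 1 -> 3 <= \sum_(0 <= j < q) (d j - 1) ->
  odd (fN q.+1 d) -> exists S : seq (pvec C q.+1 d), isUPB S /\ size S = (fN q.+1 d).+1.
Proof.
set s := \sum_(0 <= j < q) (d j - 1) => d2 sD s3 oddN.
have dq := d2 q (ltnSn q).
have sE : \sum_(j < q) (d j - 1) = s by rewrite /s big_mkord.
have eN : fN q.+1 d = s + d q by rewrite /fN big_ord_recr /= sE; lia.
pose n := (s + d q).+1./2.
have en : d q + s.+1 = n + n by move: oddN; rewrite eN /n; lia.
have sn : s < n by lia.
have [w [f [pw sf f1 flt nd]]] := exists_last_party_polynomial C s3 sn.
pose o j := \sum_(0 <= i < j) (d i - 1).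
(* The last party may be orthogonal to [d q] members, one more than a generic party of that
   dimension. The capacities still add up to only [s + d q = 2n - 1]. *)
pose cap (j : 'I_q.+1) := if (j < q)%N then (d j).-1 else d q.
pose good (j : 'I_q.+1) (vec : bool * 'I_n -> 'rV[C]_(d j)) := [/\ forall v, vec v != 0%R,
   forall y, y != 0%R -> #|[set v | hinner (vec v) y == 0%R]| <= cap j,
   (j < q)%N -> forall (k k' : 'I_n) t, o j <= t < o j + (d j - 1) -> (w ^+ k = w ^+ (k' + t))%R ->
      hinner (vec (false, k)) (vec (true, k')) = 0%R &
   j = q :> nat -> (forall b (k k' : 'I_n), k != k' -> hinner (vec (b, k)) (vec (b, k')) = 0%R) /\
      (forall k k' : 'I_n, (forall t, t < s -> (w ^+ k != w ^+ (k' + t))%R) ->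
      hinner (vec (false, k)) (vec (true, k')) = 0%R)].
have [vec Hvec] : exists vec : forall j : 'I_q.+1, bool * 'I_n -> 'rV[C]_(d j), forall j, good j (vec j).
  apply: fin_all_exists => j; have [jq|jq] := ltnP j q.
    have dj := d2 j (ltn_ord j).
    have djn : d j <= n.
      have : d j - 1 <= s by rewrite -sE (bigD1 (Ordinal jq)) //= leq_addr.
      by lia.
    have [vec [h1 h2 h3]] := generic_party pw (o j) (ltnW dj) djn.
    exists vec; split=> //.
    - by move=> y y0; rewrite /cap jq; apply: h3.
    - by move=> _ k k' t; rewrite subn1; apply: h2.
    - by move=> e; rewrite e ltnn in jq.
  have ej : d j = d q by congr d; have := ltn_ord j; lia.
  have [|vec [h1 h2 h3 h4]] := last_party pw (D := d j) sn _ sf f1 flt nd; first by rewrite ej.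
  exists vec; split=> //.
  - by move=> y y0; rewrite /cap ltnNge jq /= -ej; apply: h4.
  - by rewrite ltnNge jq.
have last_ok := Hvec ord_max; case: last_ok => _ _ _ /(_ erefl) [same cross].
have [||||S [uS cS]] := @upb_of_family C q.+1 d _ (fun v j => vec j v) cap.
- by move=> v j; have [] := Hvec j.
- have lr (k k' : 'I_n) : exists j, hinner (vec j (false, k)) (vec j (true, k')) = 0%R.
    (* A difference [k - k'] in [[0, s)] belongs to the block of one of the first [q] parties; every
       other difference is left to the last party. *)
    have [/existsP[t /eqP e]|] := boolP [exists t : 'I_s, (w ^+ k == w ^+ (k' + t))%R].
      have [j jq hj] := consecutive_block (ltn_ord t).
      exists (Ordinal (ltnW jq : j < q.+1)); have [_ _ h _] := Hvec (Ordinal (ltnW jq : j < q.+1)).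
      exact: h jq _ _ _ hj e.
    rewrite negb_exists => /forallP h; exists ord_max; apply: cross => t ts.
    exact: (h (Ordinal ts)).
  move=> [b k] [b' k'] ne; have [e|] := eqVneq b b'.
    subst b'; exists ord_max; apply: same; apply: contraNneq ne => ->; exact: eqxx.
  case: b b' {ne} => -[] // _; by have [j hj] := lr k' k; exists j; rewrite hinner_sym hj conjC0.
- by move=> j; have [] := Hvec j.
- rewrite card_prod card_bool card_ord mul2n -addnn -en big_ord_recr /= {2}/cap ltnn.
  rewrite (eq_bigr (fun j : 'I_q => d j - 1)) => [|j _]; last by rewrite /cap /= ltn_ord subn1.
  by rewrite sE; lia.
exists S; split=> //.
by rewrite cS card_prod card_bool card_ord eN; lia.
Qed.

End UpperBound.

(** * The lower bound *)

Section LowerBound.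

Lemma capacity_assignment (T I : finType) (i0 : I) (R : {set T}) (P : pred I) (c : I -> nat) :
  #|R| <= \sum_(i | P i) c i -> exists g : T -> I,
  (forall v, v \in R -> P (g v)) /\ forall i, #|[set v in R | g v == i]| <= c i.
Proof.
elim: {R}#|R| {-2}R (erefl #|R|) => [|k IH] R cR hR.
  exists (fun=> i0); have R0 : R = set0 by apply/eqP; rewrite -cards_eq0 cR.
  split=> [v|i]; first by rewrite R0 inE.
  by rewrite (_ : [set v in R | _] = set0) ?cards0 //; apply/setP => v; rewrite R0 !inE.
have [v vR] : exists v, v \in R by apply/set0Pn; rewrite -card_gt0 cR.
have cRv : #|R :\ v| = k by move: cR; rewrite (cardsD1 v) vR; case.
have [|g [gP gc]] := IH (R :\ v) cRv; first by rewrite cRv; apply: leq_trans hR; rewrite cR.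
have [i [Pi ci]] : exists i, P i /\ #|[set u in R :\ v | g u == i]| < c i.
  have [/existsP[i /andP[h1 h2]]|] := boolP [exists i, P i && (#|[set u in R :\ v | g u == i]| < c i)].
    by exists i.
  (* If every index in [P] were full, the elements placed so far would already exhaust the total
     capacity. *)
  rewrite negb_exists => /forallP h.
  have : \sum_(i | P i) c i <= #|R :\ v|.
    rewrite -sum1_card (partition_big g P) //=; apply: leq_sum => i Pi.
    have := h i; rewrite Pi -leqNgt /= => /leq_trans; apply.
    by rewrite -sum1dep_card leq_eqVlt; apply/orP; left; apply/eqP; apply: eq_bigl.
  by rewrite cRv; move: hR; rewrite cR; lia.
exists (fun u => if u == v then i else g u); split.
  by move=> u uR; case: eqVneq => // uv; apply: gP; rewrite !inE uv.
move=> i'; have [->|ne] := eqVneq i' i.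
  apply: leq_trans ci; apply: leq_trans (_ : #|v |: [set u in R :\ v | g u == i]| <= _).
    by apply/subset_leq_card/subsetP => u; rewrite !inE; case: (eqVneq u v).
  by rewrite cardsU1; case: (v \notin _).
apply: leq_trans (gc i'); apply/subset_leq_card/subsetP => u; rewrite !inE.
by case: (eqVneq u v) => //= _; rewrite eq_sym (negPf ne) andbF.
Qed.

Lemma even_degree_sum m (r : rel 'I_m) : symmetric r -> irreflexive r ->
  ~~ odd (\sum_v #|[set u | r v u]|).
Proof.
move=> rs ri.
have -> : \sum_v #|[set u | r v u]| = \sum_(v : 'I_m) \sum_(u : 'I_m) ((v < u) && r v u : nat) + \sum_(v : 'I_m) \sum_(u : 'I_m) ((u < v) && r v u : nat).
  rewrite -big_split /=; apply: eq_bigr => v _; rewrite card_sum -big_split /=.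
  by apply: eq_bigr => u _; case: ltngtP => //= [_|/val_inj e]; rewrite ?addn0 // e ri.
set A := (X in X + _); set B := (X in _ + X).
suff -> : B = A by rewrite addnn odd_double.
by rewrite /B exchange_big; apply: eq_bigr => u _; apply: eq_bigr => v _; rewrite rs.
Qed.

Local Open Scope ring_scope.
Variable C : numClosedFieldType.

Lemma exists_orthogonal (V : finType) D (z : V -> 'rV[C]_D) (R : {set V}) : (#|R| < D)%N ->
  exists2 y : 'rV[C]_D, y != 0 & forall v, v \in R -> hinner (z v) y = 0.
Proof.
move=> RD; pose A : 'M[C]_(D, #|R|) := \matrix_(i, a) (z (enum_val a) 0 i)^*.
have kA : kermx A != 0.
  by rewrite -mxrank_eq0 mxrank_ker subn_eq0 -ltnNge; apply: leq_ltn_trans RD; apply: rank_leq_col.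
exists (nz_row (kermx A)); first by rewrite nz_row_eq0.
move=> v vR; have /sub_kermxP := nz_row_sub (kermx A).
move=> /rowP /(_ (enum_rank_in vR v)); rewrite !mxE => e; rewrite -[RHS]e.
by apply: eq_bigr => i _; rewrite mxE enum_rankK_in // mulrC.
Qed.

Lemma upb_lower_bound p (d : nat -> nat) (S : seq (pvec C p d)) : (0 < p)%N ->
  (forall j, (j < p)%N -> (2 <= d j)%N) -> odd (fN p d) ->
  (exists2 j, (j < p)%N & ~~ odd (d j)) -> isUPB S -> (fN p d < size S)%N.
Proof.
move=> p0 d2 oddN [je jep je_even] [unit orth unext].
set M := size S; pose x (v : 'I_M) := tnth (in_tuple S) v.
have x0 v j : x v j != 0.
  by have /all_tnthP := (unit : all _ (in_tuple S)) => /(_ v) /andP[/forallP /(_ j)].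
have dpos (j : 'I_p) : (0 < d j)%N by apply: ltnW; apply: d2.
have orthx v v' : v != v' -> exists j, hinner (x v j) (x v' j) = 0.
  wlog lt : v v' / (v < v')%N.
    move=> W ne; have [lt|gt|e] := ltngtP v v'; first exact: W.
      have [|j hj] := W v' v gt; first by rewrite eq_sym.
      by exists j; rewrite hinner_sym hj conjC0.
    by move/val_inj: e ne => ->; rewrite eqxx.
  move=> _; have := elimT (pairwiseP (x v)) orth v v'.
  rewrite /= !inE !ltn_ord => /(_ isT isT lt).
  rewrite -!(tnth_nth (x v) (in_tuple S)) /pinner prodf_seq_eq0 => /hasP[j _ /=] /eqP h.
  by exists j.
have unextx (y : forall j : 'I_p, 'rV[C]_(d j)) : (forall j, y j != 0) ->
    exists v, forall j, hinner (x v j) (y j) != 0.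
  move=> y0; have /has_tnthP[v hv] : has (fun z => pinner z y != 0) (in_tuple S).
    by apply: unext; apply/forallP.
  exists v => j; move: hv; rewrite /pinner => /prodf_neq0 h; exact: h.
(* Outside [P] the factors are prescribed by [y0] and take care of all members outside [R]; inside
   [P] each factor is chosen orthogonal to the members assigned to it. The resulting product vector
   would extend the family. *)
have cover (R : {set 'I_M}) (P : pred 'I_p) (y0 : forall j : 'I_p, 'rV[C]_(d j)) :
    (forall j, y0 j != 0) -> (#|R| <= \sum_(j | P j) (d j - 1))%N ->
    (forall v, v \notin R -> exists2 j, ~~ P j & hinner (x v j) (y0 j) = 0) -> False.
  move=> y00 cR out.
  have [g [gP gc]] := capacity_assignment (Ordinal p0) cR.
  pose ok (j : 'I_p) (yj : 'rV[C]_(d j)) := yj != 0 /\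
    (if P j then forall v, v \in R -> g v = j -> hinner (x v j) yj = 0 else yj = y0 j).
  have [y Hy] : exists y : forall j : 'I_p, 'rV[C]_(d j), forall j, ok j (y j).
    apply: fin_all_exists => j; rewrite /ok; have [Pj|nPj] := boolP (P j); last by exists (y0 j).
    have [|y yn hy] := @exists_orthogonal _ (d j) (fun v => x v j) [set v in R | g v == j].
      by apply: leq_ltn_trans (gc j) _; rewrite subn1 prednK.
    by exists y; split=> // v vR gv; apply: hy; rewrite inE vR gv eqxx.
  have [|v hv] := unextx y; first by move=> j; have [] := Hy j.
  have [vR|vR] := boolP (v \in R).
    have [_] := Hy (g v); rewrite gP // => h.
    by case/eqP: (hv (g v)); apply: h.
  have [j nPj hj] := out v vR; have [_] := Hy j; rewrite (negPf nPj) => e.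
  by case/eqP: (hv j); rewrite e.
have total : fN p d = (\sum_(j < p) (d j - 1)).+1 by rewrite /fN addn1.
rewrite ltnNge; apply/negP => MN.
have [lt|ge] := ltnP M (fN p d).
  apply: (cover setT predT (fun j => const_mx 1)).
  - by move=> j; apply/eqP => /rowP /(_ (Ordinal (dpos j))); rewrite !mxE; apply/eqP; apply: oner_neq0.
  - by rewrite cardsT card_ord -ltnS -total.
  - by move=> v; rewrite inE.
have {MN ge} eM : M = fN p d by apply/eqP; rewrite eqn_leq MN ge.
have cM : #|'I_M| = (\sum_(j < p) (d j - 1)).+1 by rewrite card_ord eM total.
pose r j v u := hinner (x v j) (x u j) == 0.
pose deg j v := #|[set u | r j v u]|.
have rs j : symmetric (r j) by move=> v u; rewrite /r hinner_sym conjC_eq0.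
have ri j : irreflexive (r j) by move=> v; rewrite /r gt_eqF // hinner_self_gt0.
(* If [v] had too many neighbours at party [j], the factor [x v j] would deal with all of them
   there, and the remaining members, [v] included, would fit into the other parties. *)
have deg_le j v : (deg j v <= d j - 1)%N.
  rewrite leqNgt; apply/negP => big.
  apply: (cover (~: [set u | r j v u]) (predC1 j) (x v)) => //.
    have e := etrans (cardsC [set u | r j v u]) cM; rewrite (bigD1 j) //= in e.
    have aux (a b k l : nat) : (a < b -> b + k = (a + l).+1 -> k <= l)%N by lia.
    exact: aux big e.
  move=> u; rewrite !inE negbK => h; exists j; first by rewrite /= negbK.
  by rewrite hinner_sym (eqP h) conjC0.
have deg_eq j v : deg j v = (d j - 1)%N.
  (* Each of the other members is orthogonal to [v] at some party, so the degrees of [v] sum to at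
     least the number of other members, which is the sum of the upper bounds. *)
  have lower : (\sum_(j < p) (d j - 1) <= \sum_(j < p) deg j v)%N.
    have -> : (\sum_(j < p) (d j - 1) = #|[set~ v]|)%N.
      by rewrite cardsC1 cM.
    rewrite -sum1_card; rewrite /deg; under [leqRHS]eq_bigr do rewrite card_sum.
    rewrite exchange_big /= [leqLHS]big_mkcond /=; apply: leq_sum => u _.
    case: ifP => //; rewrite !inE eq_sym => /orthx [i hi].
    by rewrite (bigD1 i) //= /r hi eqxx.
  apply/eqP; rewrite eqn_leq deg_le leqNgt; apply/negP => lt.
  have rest : (\sum_(i < p | i != j) deg i v <= \sum_(i < p | i != j) (d i - 1))%N by exact: leq_sum.
  have aux (a b k l : nat) : (a < b -> k <= l -> b + l <= a + k -> False)%N by lia.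
  by rewrite (bigD1 j) //= [leqRHS](bigD1 j) //= in lower; apply: aux lt rest lower.
(* At the party of even dimension every degree is odd, and the number of members is odd too. *)
have := @even_degree_sum M (r (Ordinal jep)) (rs _) (ri _).
rewrite (eq_bigr (fun=> (d je - 1)%N)) => [|v _]; last exact: (deg_eq (Ordinal jep) v).
have dj := d2 je jep.
by rewrite sum_nat_const card_ord oddM {1}eM oddN /= oddB ?(ltnW dj) // addbT je_even.
Qed.

End LowerBound.

Theorem theorem1 (C : numClosedFieldType) (p : nat) (d : nat -> nat) :
  (2 <= p)%N ->
  (forall j, (j < p)%N -> (2 <= d j)%N) ->
  (forall i j, (i <= j)%N -> (j < p)%N -> (d i <= d j)%N) ->
  (d p.-1 - 1 >= \sum_(0 <= j < p.-1) (d j - 1))%N ->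
  (\sum_(0 <= j < p.-1) (d j - 1) >= 3)%N ->
  ~ (p = 2 /\ minn (d 0) (d 1) = 2) ->
  odd (fN p d) ->
  (exists2 j, (j < p)%N & ~~ odd (d j)) ->
  is_fm C p d (fN p d).+1.
Proof.
case: p => // q _ d2 _ sD s3 _ oddN even_d; split; first exact: upb_exists.
by move=> S; apply: upb_lower_bound.
Qed.
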